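(* Let $k\ge2$ be an integer and $m,p\in\mathbb{N}$ with $m\le p$. Suppose that $f=h+\overline{g}$ is harmonic in $\mathbb{D}$, where $h(z)=\sum_{n=k}^{\infty}a_{pn+m}z^{pn+m}$ and $g(z)=\sum_{n=k}^{\infty}b_{pn+m}z^{pn+m}$, and $h,g\in\mathcal{B}_{pk+m}$. Let $|a_{pk+m}|=|b_{pk+m}|=a\in(0,1]$ be fixed. Define $$M_{pk+m}(h,r)=\sum_{n=k}^{\infty}|a_{pn+m}|r^{pn+m}+\left(\frac1{1+|a_{pk+m}|}+\frac{r^p}{1-r^p}\right)\sum_{n=k}^{\infty}|a_{pn+m}|^2r^{p(2n-k)+m},$$ and define $M_{pk+m}(g,r)$ by the same formula with the coefficients $b_{pn+m}$ of $g$ in place of $a_{pn+m}$. Then the inequality $$M_{pk+m}(h,r)+M_{pk+m}(g,r)\le1$$ is valid for $r\in[0,\varsigma_k]$, where $\varsigma_k=\varsigma_k(a)$ is the unique root in $(0,1)$ of the equation $$(1+a)(1-r^p)-2r^{pk+m}\left[2a^2+a+r^p(1-2a^2)\right]=0.$$ The upper bound $\varsigma_k$ cannot be improved.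
   Context: $\mathbb{D}=\{z\in\mathbb{C}:|z|<1\}$ and $\mathbb N=\{1,2,\dots\}$. $\mathcal{B}$ is the class of analytic functions $\phi$ on $\mathbb{D}$ with $\sup_{z\in\mathbb{D}}|\phi(z)|\le1$, and for $j\in\mathbb{N}$, $\mathcal{B}_j=\{\phi\in\mathcal{B}:\phi(0)=\cdots=\phi^{(j-1)}(0)=0\}$. ''Cannot be improved'' means that, for the given $a$, $\varsigma_k(a)$ cannot be replaced by any larger number in $(0,1)$ so that the inequality still holds for all such $f$ with $|a_{pk+m}|=|b_{pk+m}|=a$. *)

(* Defs.v *)
(* Stdlib real numbers with Coquelicot. *)
From Stdlib Require Import Reals.
From Coquelicot Require Import Coquelicot.

Open Scope R_scope.

Definition in_disk (z : C) : Prop := Cmod z < 1.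

Definition analytic_on_disk (phi : C -> C) : Prop :=
  forall z : C, in_disk z ->
    @ex_derive C_AbsRing C_NormedModule phi z.

Definition class_B (phi : C -> C) : Prop :=
  analytic_on_disk phi /\ (forall z : C, in_disk z -> Cmod (phi z) <= 1).

(* [C_derive] is a total operator, computed by a limit along the real axis; it
   agrees with the complex derivative wherever the latter exists, so for an
   analytic [phi] this is the i-th complex derivative. *)
Definition C_derive_n (i : nat) (phi : C -> C) : C -> C :=
  Nat.iter i C_derive phi.

Definition class_Bj (j : nat) (phi : C -> C) : Prop :=
  class_B phi /\
  (forall i : nat, (i < j)%nat -> C_derive_n i phi (RtoC 0) = RtoC 0).

(* Real-valued functions of two real variables: [ex_diff_n u 2] at every point
   says that [u] is of class C^2, [partial_derive i j] differentiates i times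
   in x and j times in y. *)
Definition real_harmonic_on_disk (u : R -> R -> R) : Prop :=
  forall x y : R, in_disk (x, y) ->
    ex_diff_n u 2 x y /\
    partial_derive 2 0 u x y + partial_derive 0 2 u x y = 0.

Definition harmonic_on_disk (f : C -> C) : Prop :=
  real_harmonic_on_disk (fun x y => Re (f (x, y))) /\
  real_harmonic_on_disk (fun x y => Im (f (x, y))).

(* h(z) = sum_{n >= k} c_{pn+m} z^{pn+m} on the disk, with n = k + i. The
   entries of [c] at the other indices play no role. *)
Definition has_expansion (k p m : nat) (c : nat -> C) (h : C -> C) : Prop :=
  forall z : C, in_disk z ->
    @is_series C_AbsRing C_NormedModule
      (fun i : nat => Cmult (c (p * (k + i) + m)%nat)
                            (Cpow z (p * (k + i) + m)))
      (h z).

Record admissible (k p m : nat) (a : R) (f h g : C -> C) (ca cb : nat -> C)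
    : Prop := {
  adm_decomp : forall z : C, in_disk z -> f z = Cplus (h z) (Cconj (g z));
  adm_harmonic : harmonic_on_disk f;
  adm_exp_h : has_expansion k p m ca h;
  adm_exp_g : has_expansion k p m cb g;
  adm_Bj_h : class_Bj (p * k + m) h;
  adm_Bj_g : class_Bj (p * k + m) g;
  adm_coef_h : Cmod (ca (p * k + m)%nat) = a;
  adm_coef_g : Cmod (cb (p * k + m)%nat) = a
}.

(* The sum of a series of nonnegative terms, with value [p_infty] if it
   diverges. *)
Definition nonneg_sum (t : nat -> R) : Rbar := Lim_seq (sum_n t).

(* Both series run over n = k + i, i >= 0. *)
Definition M (k p m : nat) (c : nat -> C) (r : R) : Rbar :=
  Rbar_plus
    (nonneg_sum (fun i : nat =>
       Cmod (c (p * (k + i) + m)%nat) * r ^ (p * (k + i) + m)))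
    (Rbar_mult
       (Finite (1 / (1 + Cmod (c (p * k + m)%nat)) + r ^ p / (1 - r ^ p)))
       (nonneg_sum (fun i : nat =>
          Cmod (c (p * (k + i) + m)%nat) ^ 2
          * r ^ (p * (2 * (k + i) - k) + m)))).

Definition bohr_inequality (k p m : nat) (ca cb : nat -> C) (r : R) : Prop :=
  Rbar_le (Rbar_plus (M k p m ca r) (M k p m cb r)) (Finite 1).

Definition is_radius (k p m : nat) (a r : R) : Prop :=
  0 < r < 1 /\
  (1 + a) * (1 - r ^ p)
    - 2 * r ^ (p * k + m) * (2 * a ^ 2 + a + r ^ p * (1 - 2 * a ^ 2)) = 0.

(* Main.v *)
(* Write [h(z) = z^(pk+m) phi(z^p)] with [phi(w) = sum c_i w^i] and [x = r^p].
   Then [M(h, r)] is [r^(pk+m)] times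
   [sum |c_i| x^i + (1/(1+a) + x/(1-x)) sum |c_i|^2 x^(2i)], so it is enough to
   bound this quantity by [(2a^2+a)/(1+a) + x/(1-x)].

   Averaging [|h(z) P(z^p)|^2] over roots of unity shows that multiplication by
   [phi] is an l^2 contraction on coefficients of polynomials [P]. Suitable [P]
   give Carlson's inequalities
   [|c_(2n+1)| <= 1 - sum_(i<=n) |c_i|^2] and
   [|c_(2n+2)| <= 1 - sum_(i<=n) |c_i|^2 - |c_(n+1)|^2 / (1+a)],
   and summing these against [x^(2n+1)], [x^(2n+2)] telescopes to the bound.

   Equality holds at every [r] for [phi(w) = (a-w)/(1-aw)]. Since the bound
   times [2 r^(pk+m)] increases strictly with [r], the radius is exactly where
   it equals 1. *)
Require Import Defs.
From Stdlib Require Import Reals Lra Lia.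
From Coquelicot Require Import Coquelicot.
Open Scope R_scope.

(** * Parseval's identity over roots of unity *)

(** The test polynomials are built so that the unwanted terms on the two sides of the contraction
    cancel. A block of zero coefficients in degrees 1 to n makes the product repeat [c_0, ..., c_n]
    up to a phase, and their squares have the same total as those of the conjugated coefficients put
    in the top degrees. What survives is that the top coefficient of the product, arranged to be a
    sum of nonnegative terms, is at most 1. In the even case a middle coefficient has to be balanced
    as well, and this forces the factor [1/(1+a)], which is also the one in [M].

    The contraction uses finite averages instead of integrals. The price is an error [e] when [phi]
    is replaced by partial sums on the circle of radius [1 - e]; it is removed by letting [e] tend
    to 0.

    Sharpness asks for more than a computation: the extremal pair must be harmonic in the real C^2
    sense and its derivatives must vanish at 0. Both follow from a notion of smoothness that carries
    explicit complex derivatives. *)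

Definition csum (f : nat -> C) (n : nat) : C :=
  @sum_n (NormedModule.AbelianMonoid C_AbsRing C_NormedModule) f n.

Lemma csum_0 (f : nat -> C) : csum f 0 = f 0%nat.
Proof. exact (sum_O _). Qed.

Lemma csum_S (f : nat -> C) n : csum f (S n) = Cplus (csum f n) (f (S n)).
Proof. exact (sum_Sn _ n). Qed.

Lemma csum_ext (f g : nat -> C) n :
  (forall i, (i <= n)%nat -> f i = g i) -> csum f n = csum g n.
Proof. exact (sum_n_ext_loc _ _ n). Qed.

Lemma csum_mult_l (c : C) (f : nat -> C) n :
  csum (fun i => Cmult c (f i)) n = Cmult c (csum f n).
Proof.
induction n as [|n IH]; [now rewrite !csum_0|].
rewrite !csum_S, IH; ring.
Qed.

Lemma csum_plus (f g : nat -> C) n :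
  csum (fun i => Cplus (f i) (g i)) n = Cplus (csum f n) (csum g n).
Proof.
induction n as [|n IH]; [now rewrite !csum_0|].
rewrite !csum_S, IH; ring.
Qed.

Lemma csum_zero (f : nat -> C) n :
  (forall i, (i <= n)%nat -> f i = RtoC 0) -> csum f n = RtoC 0.
Proof.
induction n as [|n IH]; intros H.
- rewrite csum_0; apply H; lia.
- rewrite csum_S, H, IH by (try lia; intros; apply H; lia); ring.
Qed.

Lemma csum_conj (f : nat -> C) n : Cconj (csum f n) = csum (fun i => Cconj (f i)) n.
Proof.
induction n as [|n IH]; [now rewrite !csum_0|].
now rewrite !csum_S, Cplus_conj, IH.
Qed.

Lemma csum_Re (f : nat -> C) n : Re (csum f n) = sum_f_R0 (fun i => Re (f i)) n.
Proof.
induction n as [|n IH]; [now rewrite csum_0|].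
now rewrite csum_S, re_plus, IH.
Qed.

Lemma Cmod_plus_sqr (x y : C) :
  Cmod (Cplus x y) ^ 2 = Cmod x ^ 2 + Cmod y ^ 2 + 2 * Re (Cmult x (Cconj y)).
Proof. rewrite !Cmod2_alt; destruct x, y; simpl; ring. Qed.

Lemma Cmult_conj_unit (z : C) : Cmod z = 1 -> Cmult z (Cconj z) = RtoC 1.
Proof. intros H; rewrite <- Cmod2_conj, H; f_equal; ring. Qed.

Definition primitive_root (K : nat) (w : C) : Prop :=
  Cmod w = 1 /\ Cpow w K = RtoC 1 /\
  (forall l, (0 < l < K)%nat -> Cpow w l <> RtoC 1).

Lemma csum_geom (q : C) n :
  Cmult (Cminus q 1) (csum (fun j => Cpow q j) n) = Cminus (Cpow q (S n)) 1.
Proof.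
induction n as [|n IH].
- rewrite csum_0; simpl; ring.
- rewrite csum_S, Cmult_plus_distr_l, IH; simpl; ring.
Qed.

Lemma Cpow_swap (w : C) i j : Cpow (Cpow w i) j = Cpow (Cpow w j) i.
Proof. now rewrite <- !Cpow_mult_r, Nat.mul_comm. Qed.

(** On the unit circle each summand is the conjugate of [w^(t-s)] to the power j. This is a
    geometric sum whose ratio differs from 1, because [0 < t - s < K + 1], while its power [K + 1]
    is 1. *)
Lemma root_orthogonal K w s t : primitive_root (S K) w -> (s < t <= K)%nat ->
  csum (fun j => Cmult (Cpow (Cpow w j) s) (Cconj (Cpow (Cpow w j) t))) K = RtoC 0.
Proof.
intros (H1 & HK & Hp) Hst.
transitivity (Cconj (csum (fun j => Cpow (Cpow w (t - s)) j) K)).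
- rewrite csum_conj; apply csum_ext; intros j _.
  rewrite (Cpow_swap w (t - s) j).
  replace t with (s + (t - s))%nat at 1 by lia.
  rewrite Cpow_add_r, Cmult_conj, Cmult_assoc, Cmult_conj_unit; [ring|].
  now rewrite !Cmod_pow, H1, !pow1.
- pose proof (csum_geom (Cpow w (t - s)) K) as G.
  rewrite Cpow_swap, HK, Cpow_1_l in G.
  assert (E : csum (fun j => Cpow (Cpow w (t - s)) j) K = RtoC 0).
  { assert (D : Cminus (Cpow w (t - s)) 1 <> 0).
    { intros D; apply (Hp (t - s)%nat); [lia|].
      replace (Cpow w (t - s)) with (Cplus (Cminus (Cpow w (t - s)) 1) 1) by ring.
      rewrite D; ring. }
    replace (csum (fun j => Cpow (Cpow w (t - s)) j) K) with
      (Cmult (Cinv (Cminus (Cpow w (t - s)) 1))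
         (Cmult (Cminus (Cpow w (t - s)) 1) (csum (fun j => Cpow (Cpow w (t - s)) j) K)))
      by (field; exact D).
    rewrite G; ring. }
  rewrite E; unfold Cconj, RtoC; simpl; f_equal; ring.
Qed.

Lemma poly_root_orthogonal K w (f : nat -> C) n t :
  primitive_root (S K) w -> (n < t <= K)%nat ->
  csum (fun j => Cmult (csum (fun s => Cmult (f s) (Cpow (Cpow w j) s)) n)
                       (Cconj (Cpow (Cpow w j) t))) K = RtoC 0.
Proof.
intros Hw; induction n as [|n IH]; intros Hn.
- rewrite (csum_ext _ (fun j => Cmult (f 0%nat)
     (Cmult (Cpow (Cpow w j) 0) (Cconj (Cpow (Cpow w j) t))))).
  + rewrite csum_mult_l, root_orthogonal by (auto; lia); ring.
  + intros j _; rewrite csum_0; ring.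
- rewrite (csum_ext _ (fun j => Cplus
     (Cmult (csum (fun s => Cmult (f s) (Cpow (Cpow w j) s)) n)
            (Cconj (Cpow (Cpow w j) t)))
     (Cmult (f (S n)) (Cmult (Cpow (Cpow w j) (S n)) (Cconj (Cpow (Cpow w j) t)))))).
  + rewrite csum_plus, IH, csum_mult_l, root_orthogonal by (auto; lia); ring.
  + intros j _; rewrite csum_S; ring.
Qed.

(** Pythagoras, one degree at a time: the cross term with the new top monomial averages to zero by
    [poly_root_orthogonal]. Exactness needs more nodes than the degree, hence [n <= K] for [K + 1]
    nodes. *)
Lemma discrete_parseval K w (f : nat -> C) n :
  primitive_root (S K) w -> (n <= K)%nat ->
  sum_f_R0 (fun j => Cmod (csum (fun s => Cmult (f s) (Cpow (Cpow w j) s)) n) ^ 2) K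
  = INR (S K) * sum_f_R0 (fun s => Cmod (f s) ^ 2) n.
Proof.
intros Hw; pose proof Hw as (H1 & _ & _).
induction n as [|n IH]; intros Hn.
- rewrite (sum_eq _ (fun _ => Cmod (f 0%nat) ^ 2)).
  + rewrite sum_cte; simpl (sum_f_R0 _ 0); ring.
  + intros j _; rewrite csum_0; simpl (Cpow _ 0); rewrite Cmult_1_r; reflexivity.
- rewrite (sum_eq _ (fun j =>
     Cmod (csum (fun s => Cmult (f s) (Cpow (Cpow w j) s)) n) ^ 2
     + (Cmod (f (S n)) ^ 2 + Re (Cmult (Cconj (f (S n))) (Cmult
         (csum (fun s => Cmult (f s) (Cpow (Cpow w j) s)) n)
         (Cconj (Cpow (Cpow w j) (S n))))) * 2))).
  + rewrite sum_plus, IH, sum_plus, sum_cte, <- scal_sum by lia.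
    rewrite <- csum_Re, csum_mult_l, poly_root_orthogonal by (auto; lia).
    rewrite Cmult_0_r, tech5; change (Re 0) with 0; ring.
  + intros j _; rewrite csum_S, Cmod_plus_sqr, Cmod_mult, !Cmod_pow, H1, !pow1, Rmult_1_r.
    rewrite Cmult_conj, Rplus_assoc, (Rmult_comm 2).
    f_equal; f_equal. apply (f_equal (fun z => Re z * 2)). ring.
Qed.

(** * Existence of primitive roots of unity *)

Definition cis (t : R) : C := (cos t, sin t).

Lemma cis_mod t : Cmod (cis t) = 1.
Proof.
unfold Cmod, cis; cbn [fst snd].
replace (cos t ^ 2 + sin t ^ 2) with 1; [apply sqrt_1|].
pose proof (sin2_cos2 t) as H; unfold Rsqr in H; lra.
Qed.

Lemma cis_pow t n : Cpow (cis t) n = cis (INR n * t).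
Proof.
induction n as [|n IH].
- unfold cis; simpl; rewrite Rmult_0_l, cos_0, sin_0; reflexivity.
- rewrite Cpow_S, IH, S_INR.
  replace ((INR n + 1) * t) with (t + INR n * t) by ring.
  unfold cis, Cmult; simpl; rewrite cos_plus, sin_plus; f_equal; ring.
Qed.

Lemma cis_neq_1 t : 0 < t < 2 * PI -> cis t <> RtoC 1.
Proof.
intros Ht H; injection H as H _.
replace t with (2 * (t / 2)) in H by field.
rewrite cos_2a_sin in H.
assert (0 < sin (t / 2)) by (apply sin_gt_0; lra).
nra.
Qed.

Lemma cis_primitive_root K : primitive_root (S K) (cis (2 * PI / INR (S K))).
Proof.
assert (HK : 0 < INR (S K)) by (apply lt_0_INR; lia).
pose proof PI_RGT_0.
split; [apply cis_mod|split].
- rewrite cis_pow; replace (INR (S K) * (2 * PI / INR (S K))) with (2 * PI) by (field; lra).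
  unfold cis; rewrite cos_2PI, sin_2PI; reflexivity.
- intros l Hl; rewrite cis_pow; apply cis_neq_1.
  assert (0 < INR l) by (apply lt_0_INR; lia).
  assert (INR l < INR (S K)) by (apply lt_INR; lia).
  split.
  + apply Rmult_lt_0_compat; auto; apply Rdiv_lt_0_compat; lra.
  + apply Rmult_lt_reg_r with (INR (S K)); auto.
    replace (INR l * (2 * PI / INR (S K)) * INR (S K)) with (INR l * (2 * PI)) by (field; lra).
    nra.
Qed.

(** * Multiplication by a bounded power series *)

Lemma is_series_C_eventually (a : nat -> C) (l : C) :
  @is_series C_AbsRing C_NormedModule a l <->
  (forall eps : posreal, exists n0, forall n, (n0 <= n)%nat ->
     Cmod (Cminus (csum a n) l) < eps).
Proof.
exact (@filterlim_locally_ball_norm C_AbsRing nat C_NormedModule eventually _ (csum a) l).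
Qed.

(** Two consecutive partial sums at [r'] eventually lie within 1 of the limit, so the terms there
    are at most 2, and a geometric series of ratio [r / r'] dominates at [r]. *)
Lemma power_series_abs_converges (c : nat -> C) (r r' : R) (l : C) :
  0 <= r < r' ->
  @is_series C_AbsRing C_NormedModule (fun i => Cmult (c i) (Cpow r' i)) l ->
  ex_series (fun i => Cmod (c i) * r ^ i).
Proof.
intros Hr H.
destruct (proj1 (is_series_C_eventually _ _) H (mkposreal 1 Rlt_0_1)) as [n0 Hn0].
simpl in Hn0.
apply (ex_series_incr_n _ (S n0)).
apply (@ex_series_le R_AbsRing R_CompleteNormedModule) with (b := fun i => 2 * (r / r') ^ (S n0 + i)).
- intros i; set (k := (S n0 + i)%nat).
  change (Rabs (Cmod (c k) * r ^ k) <= 2 * (r / r') ^ k).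
  pose proof (Hn0 k ltac:(lia)) as H1.
  pose proof (Hn0 (n0 + i)%nat ltac:(lia)) as H2.
  unfold k in H1 |- *; simpl Nat.add in *.
  rewrite csum_S in H1; fold k in H1 |- *.
  set (x := csum _ (n0 + i)) in *.
  assert (B : Cmod (Cmult (c k) (Cpow r' k)) <= 2).
  { replace (Cmult (c k) (Cpow r' k)) with
      (Cplus (Cminus (Cplus x (Cmult (c k) (Cpow r' k))) l) (Copp (Cminus x l))) by ring.
    eapply Rle_trans; [apply Cmod_triangle|]; rewrite Cmod_opp; unfold k in *; simpl in *; lra. }
  rewrite Cmod_mult, Cmod_pow, Cmod_R, Rabs_pos_eq in B by lra.
  rewrite Rabs_pos_eq by (apply Rmult_le_pos; [apply Cmod_ge_0|apply pow_le; lra]).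
  replace r with (r' * (r / r')) at 1 by (field; lra).
  rewrite Rpow_mult_distr, <- Rmult_assoc.
  apply Rmult_le_compat_r; [|exact B].
  apply pow_le, Rdiv_le_0_compat; lra.
- apply (ex_series_incr_n (fun k => 2 * (r / r') ^ k)).
  apply (@ex_series_scal R_AbsRing R_NormedModule 2 (fun k => (r / r') ^ k)).
  apply ex_series_geom; rewrite Rabs_pos_eq by (apply Rdiv_le_0_compat; lra).
  apply Rmult_lt_reg_r with r'; [lra|].
  replace (r / r' * r') with r by (field; lra); lra.
Qed.

Lemma csum_diff_le (f : nat -> C) n m : (n <= m)%nat ->
  Cmod (csum f n) <= Cmod (csum f m)
     + (sum_f_R0 (fun i => Cmod (f i)) m - sum_f_R0 (fun i => Cmod (f i)) n).
Proof.
induction 1 as [|m _ IH]; [lra|].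
rewrite csum_S; simpl.
pose proof (Cmod_triangle (Cplus (csum f m) (f (S m))) (Copp (f (S m)))) as T.
replace (Cplus (Cplus (csum f m) (f (S m))) (Copp (f (S m)))) with (csum f m) in T by ring.
rewrite Cmod_opp in T; lra.
Qed.

(** The error is the tail of the series of absolute values, which depends on [w] only through its
    modulus. A single [n] therefore serves a whole circle. *)
Lemma partial_sum_le (c : nat -> C) (w l : C) n :
  @is_series C_AbsRing C_NormedModule (fun i => Cmult (c i) (Cpow w i)) l ->
  ex_series (fun i => Cmod (c i) * Cmod w ^ i) ->
  Cmod (csum (fun i => Cmult (c i) (Cpow w i)) n) <=
  Cmod l + (Series (fun i => Cmod (c i) * Cmod w ^ i)
            - sum_f_R0 (fun i => Cmod (c i) * Cmod w ^ i) n).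
Proof.
intros H E; apply le_epsilon; intros eps Heps.
destruct (proj1 (is_series_C_eventually _ _) H (mkposreal eps Heps)) as [m0 Hm].
set (m := max n m0).
pose proof (Hm m ltac:(unfold m; lia)) as H1; simpl in H1.
pose proof (csum_diff_le (fun i => Cmult (c i) (Cpow w i)) n m ltac:(unfold m; lia)) as H2.
assert (Eq : forall k, sum_f_R0 (fun i => Cmod (Cmult (c i) (Cpow w i))) k =
                  sum_f_R0 (fun i => Cmod (c i) * Cmod w ^ i) k).
{ intros k; apply sum_eq; intros i _; now rewrite Cmod_mult, Cmod_pow. }
rewrite !Eq in H2.
assert (H3 : sum_f_R0 (fun i => Cmod (c i) * Cmod w ^ i) m
             <= Series (fun i => Cmod (c i) * Cmod w ^ i)).
{ apply sum_incr.
  - apply is_series_Reals, Series_correct, E.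
  - intros i; apply Rmult_le_pos; [apply Cmod_ge_0|apply pow_le, Cmod_ge_0]. }
set (x := csum _ m) in *.
pose proof (Cmod_triangle (Cminus x l) l) as T.
replace (Cplus (Cminus x l) l) with x in T by ring; lra.
Qed.

Definition convolution (A B : nat -> C) (s : nat) : C :=
  csum (fun i => Cmult (A i) (B (s - i)%nat)) s.

(** The triangle [i + j <= M] is summed by antidiagonals on the left and by rows on the right; the
    step to [S M] adds one antidiagonal. *)
Lemma csum_convolution (A B : nat -> C) (w : C) M :
  csum (fun s => Cmult (convolution A B s) (Cpow w s)) M =
  csum (fun i => Cmult (Cmult (A i) (Cpow w i))
                       (csum (fun j => Cmult (B j) (Cpow w j)) (M - i))) M.
Proof.
induction M as [|M IH].
- unfold convolution; simpl (0 - 0)%nat; rewrite !csum_0; simpl; ring.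
- rewrite csum_S, IH.
  rewrite (csum_S (fun i => Cmult _ _) M).
  unfold convolution; rewrite csum_S, Nat.sub_diag, csum_0.
  rewrite (csum_ext
    (fun i => Cmult (Cmult (A i) (Cpow w i)) (csum (fun j => Cmult (B j) (Cpow w j)) (S M - i)))
    (fun i => Cplus
       (Cmult (Cmult (A i) (Cpow w i)) (csum (fun j => Cmult (B j) (Cpow w j)) (M - i)))
       (Cmult (Cpow w (S M)) (Cmult (A i) (B (S M - i)%nat))))).
  + rewrite csum_plus, csum_mult_l; change (Cpow w 0) with (RtoC 1); ring.
  + intros i Hi; replace (S M - i)%nat with (S (M - i)) by lia.
    rewrite csum_S; replace (Cpow w (S M)) with (Cmult (Cpow w i) (Cpow w (S (M - i)))).
    * ring.
    * rewrite <- Cpow_add_r; f_equal; lia.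
Qed.

Lemma csum_trunc (f : nat -> C) n d :
  (forall i, (n < i)%nat -> f i = RtoC 0) -> csum f (n + d) = csum f n.
Proof.
intros H; induction d as [|d IH]; [now rewrite Nat.add_0_r|].
rewrite Nat.add_succ_r, csum_S, IH, H by lia; ring.
Qed.

(** Cutting [c] at [n] turns its product with a polynomial of degree [d] into a polynomial of degree
    [n + d], to which the discrete Parseval identity applies, without changing the coefficients of
    the product up to [n]. *)
Definition truncate (c : nat -> C) (n i : nat) : C :=
  if Nat.leb i n then c i else RtoC 0.

Lemma truncate_in c n i : (i <= n)%nat -> truncate c n i = c i.
Proof. intros H; unfold truncate; now rewrite (proj2 (Nat.leb_le _ _) H). Qed.

Lemma truncate_out c n i : (n < i)%nat -> truncate c n i = RtoC 0.
Proof. intros H; unfold truncate; now rewrite (proj2 (Nat.leb_gt _ _) H). Qed.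

Lemma csum_mul_poly (c P : nat -> C) (w : C) n d :
  (forall j, (d < j)%nat -> P j = RtoC 0) ->
  csum (fun s => Cmult (convolution (truncate c n) P s) (Cpow w s)) (n + d) =
  Cmult (csum (fun i => Cmult (c i) (Cpow w i)) n)
        (csum (fun j => Cmult (P j) (Cpow w j)) d).
Proof.
intros HP; rewrite csum_convolution, csum_trunc.
- rewrite Cmult_comm, <- csum_mult_l; apply csum_ext; intros i Hi.
  rewrite truncate_in by lia.
  replace (n + d - i)%nat with (d + (n - i))%nat by lia.
  rewrite csum_trunc; [ring|].
  intros j Hj; rewrite HP by lia; ring.
- intros i Hi; rewrite truncate_out by lia; ring.
Qed.

Lemma sum_f_R0_le_more (f : nat -> R) n m : (forall i, 0 <= f i) -> (n <= m)%nat ->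
  sum_f_R0 f n <= sum_f_R0 f m.
Proof.
intros Hf; induction 1 as [|m _ IH]; [lra|]; simpl; specialize (Hf (S m)); lra.
Qed.

(** Parseval at the same [n + d + 1] nodes for the truncated product and for [P], compared node by
    node through the bound [B] on the partial sums of [c]. *)
Lemma contraction_on_circle (c P : nat -> C) (r B : R) n d L :
  0 < r -> 0 <= B -> (L <= n)%nat ->
  (forall j, (d < j)%nat -> P j = RtoC 0) ->
  (forall t, Cmod (csum (fun i => Cmult (c i) (Cpow (Cmult r (cis t)) i)) n) <= B) ->
  sum_f_R0 (fun s => Cmod (convolution c P s) ^ 2 * (r ^ s) ^ 2) L <=
  B ^ 2 * sum_f_R0 (fun j => Cmod (P j) ^ 2 * (r ^ j) ^ 2) d.
Proof.
intros Hr HB HL HP Hc.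
set (K := (n + d)%nat).
set (w := cis (2 * PI / INR (S K))).
pose proof (cis_primitive_root K : primitive_root (S K) w) as Hw.
assert (HK : 0 < INR (S K)) by (apply lt_0_INR; lia).
assert (Scale : forall (f : nat -> C) N j,
  csum (fun s => Cmult (Cmult (f s) (Cpow r s)) (Cpow (Cpow w j) s)) N =
  csum (fun s => Cmult (f s) (Cpow (Cmult r (Cpow w j)) s)) N).
{ intros f N j; apply csum_ext; intros s _; rewrite Cpow_mult_l; ring. }
assert (Mod : forall (f : nat -> C) N,
  sum_f_R0 (fun s => Cmod (Cmult (f s) (Cpow r s)) ^ 2) N =
  sum_f_R0 (fun s => Cmod (f s) ^ 2 * (r ^ s) ^ 2) N).
{ intros f N; apply sum_eq; intros s _.
  rewrite Cmod_mult, Cmod_pow, Cmod_R, Rabs_pos_eq by lra; ring. }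
pose proof (discrete_parseval K w
  (fun s => Cmult (convolution (truncate c n) P s) (Cpow r s)) K Hw (le_n _)) as E1.
pose proof (discrete_parseval K w
  (fun s => Cmult (P s) (Cpow r s)) d Hw ltac:(unfold K; lia)) as E2.
cbv beta in E1, E2; rewrite Mod in E1, E2.
apply Rle_trans with
  (sum_f_R0 (fun s => Cmod (convolution (truncate c n) P s) ^ 2 * (r ^ s) ^ 2) K).
- rewrite (sum_eq _ (fun s => Cmod (convolution (truncate c n) P s) ^ 2 * (r ^ s) ^ 2) L).
  + apply sum_f_R0_le_more; [|unfold K; lia].
    intros i; apply Rmult_le_pos; apply pow2_ge_0.
  + intros s Hs; do 3 f_equal; apply csum_ext; intros i Hi.
    now rewrite truncate_in by lia.
- apply Rmult_le_reg_l with (INR (S K)); [exact HK|].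
  rewrite <- E1.
  replace (INR (S K) * (B ^ 2 * sum_f_R0 (fun j => Cmod (P j) ^ 2 * (r ^ j) ^ 2) d))
    with (B ^ 2 * (INR (S K) * sum_f_R0 (fun j => Cmod (P j) ^ 2 * (r ^ j) ^ 2) d)) by ring.
  rewrite <- E2, scal_sum; apply sum_Rle; intros j _.
  rewrite !Scale; unfold K; rewrite csum_mul_poly, Cmod_mult, Rpow_mult_distr, Rmult_comm
    by exact HP.
  apply Rmult_le_compat_l; [apply pow2_ge_0|].
  apply pow_incr; split; [apply Cmod_ge_0|].
  unfold w; rewrite cis_pow; apply Hc.
Qed.

Lemma nonneg_at_0 (g : R -> R) :
  continuity_pt g 0 -> (forall e, 0 < e < 1 -> 0 <= g e) -> 0 <= g 0.
Proof.
intros Hg H; destruct (Rle_or_lt 0 (g 0)) as [|Hn]; [assumption|exfalso].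
destruct (Hg (- g 0) ltac:(lra)) as (d & Hd & Hx).
set (e := Rmin (d / 2) (1 / 2)).
assert (He : 0 < e <= d / 2 /\ e <= 1 / 2).
{ unfold e; repeat split; [apply Rmin_glb_lt; lra|apply Rmin_l|apply Rmin_r]. }
pose proof (H e ltac:(lra)) as H1.
specialize (Hx e); simpl in Hx; unfold Rdist in Hx.
assert (Hx' : Rabs (g e - g 0) < - g 0).
{ apply Hx; split; [split; [exact I|lra]|]; rewrite Rminus_0_r, Rabs_pos_eq; lra. }
apply Rabs_def2 in Hx'; lra.
Qed.

(* The weight [r ^ q] allows to apply this to [h(z) = z^q phi(z^p)] without
   first dividing out [z^q] by Schwarz' lemma: it disappears as [r -> 1]. *)
Definition schur_sequence (q : nat) (c : nat -> C) : Prop :=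
  forall r t, 0 < r < 1 -> exists l,
    @is_series C_AbsRing C_NormedModule
      (fun i => Cmult (c i) (Cpow (Cmult r (cis t)) i)) l /\
    r ^ q * Cmod l <= 1.

Lemma schur_contraction q (c P : nat -> C) d L :
  schur_sequence q c ->
  (forall j, (d < j)%nat -> P j = RtoC 0) ->
  sum_f_R0 (fun s => Cmod (convolution c P s) ^ 2) L <=
  sum_f_R0 (fun j => Cmod (P j) ^ 2) d.
Proof.
intros Hc HP.
set (X := sum_f_R0 _ L); set (Y := sum_f_R0 _ d).
enough (H : forall e, 0 < e < 1 -> (1 - e) ^ (2 * q + 2 * L) * X <= (1 + e) ^ 2 * Y).
{ pose proof (nonneg_at_0 (fun e => (1 + e) ^ 2 * Y - (1 - e) ^ (2 * q + 2 * L) * X)) as Z.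
  cbv beta in Z; rewrite Rplus_0_r, Rminus_0_r, !pow1 in Z.
  enough (0 <= 1 * Y - 1 * X) by lra; apply Z.
  - apply derivable_continuous_pt; reg.
  - intros e He; specialize (H e He); lra. }
intros e He; set (r := 1 - e).
assert (Hr : 0 < r < 1) by (unfold r; lra).
assert (Hrq : 0 < r ^ q) by (apply pow_lt; lra).
assert (E : ex_series (fun i => Cmod (c i) * r ^ i)).
{ destruct (Hc ((1 + r) / 2) 0 ltac:(lra)) as (l & Hl & _).
  apply power_series_abs_converges with ((1 + r) / 2) l; [lra|].
  revert Hl; apply is_series_ext; intros i; do 2 f_equal.
  unfold cis; rewrite cos_0, sin_0; apply Cmult_1_r. }
assert (Hn : exists n, (L <= n)%nat /\
  Series (fun i => Cmod (c i) * r ^ i) - sum_f_R0 (fun i => Cmod (c i) * r ^ i) n <= e).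
{ pose proof (Series_correct _ E) as S; apply is_series_Reals in S.
  destruct (S e ltac:(lra)) as (n0 & Hn0).
  exists (max L n0); split; [lia|].
  specialize (Hn0 (max L n0) ltac:(lia)); unfold Rdist in Hn0.
  apply Rabs_def2 in Hn0; lra. }
destruct Hn as (n & HLn & Hn).
assert (Hmod : forall t, Cmod (Cmult r (cis t)) = r).
{ intros t; rewrite Cmod_mult, cis_mod, Cmod_R, Rabs_pos_eq; lra. }
pose proof (contraction_on_circle c P r (/ r ^ q + e) n d L) as Main.
assert (Hinv : 0 < / r ^ q) by (apply Rinv_0_lt_compat; lra).
specialize (Main ltac:(lra) ltac:(lra) HLn HP).
assert (M : sum_f_R0 (fun s => Cmod (convolution c P s) ^ 2 * (r ^ s) ^ 2) L <=
  (/ r ^ q + e) ^ 2 * sum_f_R0 (fun j => Cmod (P j) ^ 2 * (r ^ j) ^ 2) d).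
{ apply Main; intros t; destruct (Hc r t Hr) as (l & Hl & Hb).
  pose proof (partial_sum_le c (Cmult r (cis t)) l n Hl) as Hp.
  rewrite Hmod in Hp; specialize (Hp E).
  assert (Cmod l <= / r ^ q); [|lra].
  apply Rmult_le_reg_l with (r ^ q); [lra|]; rewrite Rinv_r; lra. }
clear Main.
assert (HX : (r ^ L) ^ 2 * X <= sum_f_R0 (fun s => Cmod (convolution c P s) ^ 2 * (r ^ s) ^ 2) L).
{ unfold X; rewrite scal_sum; apply sum_Rle; intros s Hs.
  apply Rmult_le_compat_l; [apply pow2_ge_0|].
  apply pow_incr; split; [apply pow_le; lra|].
  replace L with (s + (L - s))%nat by lia; rewrite pow_add.
  rewrite <- (Rmult_1_r (r ^ s)) at 2; apply Rmult_le_compat_l; [apply pow_le; lra|].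
  rewrite <- (pow1 (L - s)); apply pow_incr; lra. }
assert (HY : sum_f_R0 (fun j => Cmod (P j) ^ 2 * (r ^ j) ^ 2) d <= Y).
{ apply sum_Rle; intros j _.
  rewrite <- (Rmult_1_r (Cmod (P j) ^ 2)) at 2; apply Rmult_le_compat_l; [apply pow2_ge_0|].
  rewrite <- !pow_mult, <- (pow1 (j * 2)); apply pow_incr; lra. }
assert (HY0 : 0 <= Y) by (apply cond_pos_sum; intros; apply pow2_ge_0).
rewrite pow_add, !(Nat.mul_comm 2), !pow_mult.
apply Rle_trans with ((r ^ q) ^ 2 * ((/ r ^ q + e) ^ 2 * Y)).
- rewrite Rmult_assoc; apply Rmult_le_compat_l; [apply pow2_ge_0|].
  eapply Rle_trans; [exact HX|]; eapply Rle_trans; [exact M|].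
  apply Rmult_le_compat_l; [apply pow2_ge_0|exact HY].
- rewrite <- Rmult_assoc, <- Rpow_mult_distr; apply Rmult_le_compat_r; [exact HY0|].
  apply pow_incr; rewrite Rmult_plus_distr_l, Rinv_r by lra.
  assert (r ^ q <= 1) by (rewrite <- (pow1 q); apply pow_incr; lra).
  split; nra.
Qed.

(** * Carlson's inequalities *)

Lemma unit_phase (z : C) : exists u : C, Cmod u = 1 /\ Cmult z u = RtoC (Cmod z).
Proof.
destruct (Req_dec (Cmod z) 0) as [H|H].
- exists 1; rewrite Cmod_1, H, (Cmod_eq_0 _ H); split; [reflexivity|ring].
- exists (Cdiv (Cconj z) (RtoC (Cmod z))).
  assert (RtoC (Cmod z) <> 0) by (intros E; apply H; now injection E).
  split.
  + rewrite Cmod_div, Cmod_conj, Cmod_R, Rabs_pos_eq by (auto using Cmod_ge_0); field; auto.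
  + transitivity (Cdiv (Cmult z (Cconj z)) (RtoC (Cmod z))); [unfold Cdiv; ring|].
    rewrite <- Cmod2_conj, <- RtoC_div by auto; f_equal; field; auto.
Qed.

Lemma csum_split (f : nat -> C) n m :
  csum f (n + S m) = Cplus (csum f n) (csum (fun i => f (S n + i)%nat) m).
Proof.
induction m as [|m IH].
- rewrite Nat.add_1_r, csum_S, csum_0, Nat.add_0_r; reflexivity.
- rewrite Nat.add_succ_r, csum_S, IH, csum_S.
  replace (S (n + S m)) with (S n + S m)%nat by lia; ring.
Qed.

Lemma csum_last (f : nat -> C) n :
  (forall i, (i < n)%nat -> f i = RtoC 0) -> csum f n = f n.
Proof.
destruct n as [|n]; intros H; [apply csum_0|].
rewrite csum_S, csum_zero by (intros; apply H; lia); ring.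
Qed.

Lemma sum_split (f : nat -> R) n m :
  sum_f_R0 f (n + S m) = sum_f_R0 f n + sum_f_R0 (fun i => f (S n + i)%nat) m.
Proof.
rewrite (tech2 f n (n + S m)) by lia; do 2 f_equal; lia.
Qed.

Lemma sum_rev (f : nat -> R) n : sum_f_R0 (fun i => f (n - i)%nat) n = sum_f_R0 f n.
Proof.
induction n as [|n IH]; [reflexivity|].
rewrite decomp_sum by lia; simpl pred; rewrite tech5, <- IH, Nat.sub_0_r; simpl; ring.
Qed.

Lemma sum_first (f : nat -> R) n :
  (forall i, (0 < i <= n)%nat -> f i = 0) -> sum_f_R0 f n = f 0%nat.
Proof.
induction n as [|n IH]; intros H; [reflexivity|].
rewrite tech5, (H (S n)), IH by (try lia; intros; apply H; lia); ring.
Qed.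

Lemma Cmod_pos_real (x : R) : 0 <= x -> Cmod (RtoC x) = x.
Proof. intros H; rewrite Cmod_R; now apply Rabs_pos_eq. Qed.

Lemma csum_Cmod2 (c : nat -> C) n :
  csum (fun i => Cmult (c i) (Cconj (c i))) n
  = RtoC (sum_f_R0 (fun i => Cmod (c i) ^ 2) n).
Proof.
induction n as [|n IH]; [rewrite csum_0; now rewrite <- Cmod2_conj|].
now rewrite csum_S, IH, tech5, RtoC_plus, <- Cmod2_conj.
Qed.

Lemma sum_Cmod2_pos (c : nat -> C) n : 0 <= sum_f_R0 (fun i => Cmod (c i) ^ 2) n.
Proof. apply cond_pos_sum; intros; apply pow2_ge_0. Qed.

(* Tested on the polynomial [u + sum_{j <= n} conj(c_j) w^(2n+1-j)], where the
   unit [u] makes [u c_(2n+1)] nonnegative. *)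
Lemma carlson_odd q c n : schur_sequence q c ->
  Cmod (c (2 * n + 1)%nat) + sum_f_R0 (fun i => Cmod (c i) ^ 2) n <= 1.
Proof.
intros Hc; set (S0 := sum_f_R0 _ n).
assert (HS : 0 <= S0) by apply sum_Cmod2_pos.
destruct (unit_phase (c (2 * n + 1)%nat)) as (u & Hu & Hb).
set (b := Cmod (c (2 * n + 1)%nat)) in *.
assert (Hb0 : 0 <= b) by apply Cmod_ge_0.
set (T := (n + S n)%nat); replace (2 * n + 1)%nat with T in Hb by (unfold T; lia).
set (P := fun j => if Nat.eqb j 0 then u else if Nat.leb j n then RtoC 0
                   else truncate (fun j => Cconj (c (T - j)%nat)) T j).
assert (P0 : P 0%nat = u) by reflexivity.
assert (Plow : forall j, (0 < j <= n)%nat -> P j = RtoC 0).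
{ intros j Hj; unfold P; rewrite (proj2 (Nat.eqb_neq _ _)), (proj2 (Nat.leb_le _ _)) by lia.
  reflexivity. }
assert (Phigh : forall j, (n < j <= T)%nat -> P j = Cconj (c (T - j)%nat)).
{ intros j Hj; unfold P; rewrite (proj2 (Nat.eqb_neq _ _)), (proj2 (Nat.leb_gt _ _)) by lia.
  now rewrite truncate_in by lia. }
assert (Pout : forall j, (T < j)%nat -> P j = RtoC 0).
{ intros j Hj; unfold P.
  rewrite (proj2 (Nat.eqb_neq _ _)), (proj2 (Nat.leb_gt _ _)) by (unfold T in Hj; lia).
  now rewrite truncate_out by lia. }
pose proof (schur_contraction q c P T T Hc Pout) as Main.
assert (E1 : forall s, (s <= n)%nat -> convolution c P s = Cmult (c s) u).
{ intros s Hs; unfold convolution; rewrite csum_last.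
  - now rewrite Nat.sub_diag, P0.
  - intros i Hi; rewrite Plow by lia; ring. }
assert (E2 : convolution c P T = RtoC (S0 + b)).
{ unfold convolution; unfold T at 2; rewrite csum_split,
    (csum_last (fun i => Cmult (c (S n + i)%nat) (P (T - (S n + i))%nat))).
  - replace (S n + n)%nat with T by (unfold T; lia).
    rewrite Nat.sub_diag, P0, Hb, RtoC_plus; f_equal.
    unfold S0; rewrite <- csum_Cmod2; apply csum_ext; intros i Hi.
    rewrite Phigh by (unfold T; lia); do 2 f_equal; f_equal; unfold T; lia.
  - intros i Hi; rewrite Plow by (unfold T; lia); ring. }
(* Only the degrees up to [n] and the top degree of the product are kept. Since [P] has squared norm
   [1 + S0], the contraction leaves [(S0 + b)^2 <= 1]. *)
assert (L1 : S0 + (S0 + b) ^ 2 <= sum_f_R0 (fun s => Cmod (convolution c P s) ^ 2) T).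
{ unfold T; rewrite Nat.add_succ_r, tech5, <- Nat.add_succ_r.
  fold T; rewrite E2, Cmod_pos_real by lra.
  apply Rplus_le_compat_r.
  apply Rle_trans with (sum_f_R0 (fun s => Cmod (convolution c P s) ^ 2) n).
  - apply Req_le, sum_eq; intros s Hs; rewrite E1, Cmod_mult, Hu by lia; ring.
  - apply sum_f_R0_le_more; [intros; apply pow2_ge_0|lia]. }
assert (L2 : sum_f_R0 (fun j => Cmod (P j) ^ 2) T = 1 + S0).
{ unfold T; rewrite sum_split, sum_first, P0, Hu.
  - f_equal; [ring|]; unfold S0; rewrite <- sum_rev; apply sum_eq; intros i Hi.
    rewrite Phigh, Cmod_conj by (unfold T; lia); do 3 f_equal; unfold T; lia.
  - intros i Hi; rewrite Plow, Cmod_0 by lia; ring. }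
rewrite L2 in Main; nra.
Qed.

(* As for [carlson_odd], with the additional coefficient
   [conj(c_(n+1)) / (1 + |c_0|)] in degree [n+1]. *)
Lemma carlson_even q c n : schur_sequence q c ->
  Cmod (c (2 * n + 2)%nat) + sum_f_R0 (fun i => Cmod (c i) ^ 2) n
    + Cmod (c (S n)) ^ 2 / (1 + Cmod (c 0%nat)) <= 1.
Proof.
intros Hc; set (S0 := sum_f_R0 _ n).
assert (HS : 0 <= S0) by apply sum_Cmod2_pos.
destruct (unit_phase (c (2 * n + 2)%nat)) as (u & Hu & Hb).
set (b := Cmod (c (2 * n + 2)%nat)) in *.
assert (Hb0 : 0 <= b) by apply Cmod_ge_0.
set (a := Cmod (c 0%nat)); assert (Ha : 0 <= a) by apply Cmod_ge_0.
set (x := Cmod (c (S n))); assert (Hx : 0 <= x) by apply Cmod_ge_0.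
(* In degree [n + 1] the product has modulus at least [(1 - mu * a) * x], whereas [P] has modulus
   [mu * x]. The value of [mu] makes the two equal, so their squares cancel at the end. *)
set (mu := / (1 + a)).
assert (Hmu : 0 < mu) by (apply Rinv_0_lt_compat; lra).
assert (Hmua : mu * a = 1 - mu) by (unfold mu; field; lra).
change (x ^ 2 / (1 + a)) with (x ^ 2 * mu).
set (T := (S n + S n)%nat); replace (2 * n + 2)%nat with T in Hb by (unfold T; lia).
set (P := fun j => if Nat.eqb j 0 then u else if Nat.leb j n then RtoC 0
   else if Nat.eqb j (S n) then Cmult mu (Cconj (c (S n)))
   else truncate (fun j => Cconj (c (T - j)%nat)) T j).
assert (P0 : P 0%nat = u) by reflexivity.
assert (Plow : forall j, (0 < j <= n)%nat -> P j = RtoC 0).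
{ intros j Hj; unfold P; rewrite (proj2 (Nat.eqb_neq _ _)), (proj2 (Nat.leb_le _ _)) by lia.
  reflexivity. }
assert (Pmid : P (S n) = Cmult mu (Cconj (c (S n)))).
{ unfold P; rewrite (proj2 (Nat.eqb_neq _ _)), (proj2 (Nat.leb_gt _ _)), Nat.eqb_refl by lia.
  reflexivity. }
assert (Phigh : forall j, (S n < j <= T)%nat -> P j = Cconj (c (T - j)%nat)).
{ intros j Hj; unfold P.
  rewrite (proj2 (Nat.eqb_neq _ _)), (proj2 (Nat.leb_gt _ _)), (proj2 (Nat.eqb_neq j _)) by lia.
  now rewrite truncate_in by lia. }
assert (Pout : forall j, (T < j)%nat -> P j = RtoC 0).
{ intros j Hj; unfold P, T in *.
  rewrite (proj2 (Nat.eqb_neq _ _)), (proj2 (Nat.leb_gt _ _)), (proj2 (Nat.eqb_neq j _)) by lia.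
  now rewrite truncate_out by lia. }
pose proof (schur_contraction q c P T T Hc Pout) as Main.
assert (E1 : forall s, (s <= n)%nat -> convolution c P s = Cmult (c s) u).
{ intros s Hs; unfold convolution; rewrite csum_last.
  - now rewrite Nat.sub_diag, P0.
  - intros i Hi; rewrite Plow by lia; ring. }
(* The middle index [S n] is paired with itself because [T] is twice [S n]; it contributes
   [x ^ 2 * mu]. *)
assert (E2 : convolution c P T = RtoC (S0 + x ^ 2 * mu + b)).
{ unfold convolution; unfold T at 2; rewrite csum_split, (csum_last _ n).
  - replace (S (S n) + n)%nat with T by (unfold T; lia).
    rewrite Nat.sub_diag, P0, Hb, RtoC_plus; f_equal.
    rewrite csum_S; replace (T - S n)%nat with (S n) by (unfold T; lia).
    rewrite Pmid, RtoC_plus, RtoC_mult; f_equal.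
    + unfold S0; rewrite <- csum_Cmod2; apply csum_ext; intros i Hi.
      rewrite Phigh by (unfold T; lia); do 2 f_equal; f_equal; unfold T; lia.
    + unfold x; rewrite Cmod2_conj; ring.
  - intros i Hi; rewrite Plow by (unfold T; lia); ring. }
assert (E3 : x * mu <= Cmod (convolution c P (S n))).
{ replace (convolution c P (S n)) with
    (Cplus (Cmult (c 0%nat) (Cmult mu (Cconj (c (S n))))) (Cmult (c (S n)) u)).
  - pose proof (Cmod_triangle
      (Cplus (Cmult (c 0%nat) (Cmult mu (Cconj (c (S n))))) (Cmult (c (S n)) u))
      (Copp (Cmult (c 0%nat) (Cmult mu (Cconj (c (S n))))))) as T1.
    replace (Cplus (Cplus (Cmult (c 0%nat) (Cmult mu (Cconj (c (S n))))) (Cmult (c (S n)) u))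
      (Copp (Cmult (c 0%nat) (Cmult mu (Cconj (c (S n)))))))
      with (Cmult (c (S n)) u) in T1 by ring.
    rewrite Cmod_opp, !(Cmod_mult (c _)), Cmod_mult, Cmod_conj, Hu, Cmod_pos_real in T1 by lra.
    fold a x in T1; nra.
  - unfold convolution; rewrite (csum_split _ 0 n), csum_0, (csum_last _ n).
    + simpl Nat.add; now rewrite Nat.sub_diag, P0, Nat.sub_0_r, Pmid.
    + intros i Hi; rewrite Plow by lia; ring. }
assert (L1 : S0 + (x * mu) ^ 2 + (S0 + x ^ 2 * mu + b) ^ 2
             <= sum_f_R0 (fun s => Cmod (convolution c P s) ^ 2) T).
{ unfold T; rewrite Nat.add_succ_r, tech5, <- Nat.add_succ_r.
  fold T; rewrite E2, Cmod_pos_real by nra.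
  apply Rplus_le_compat_r.
  apply Rle_trans with (sum_f_R0 (fun s => Cmod (convolution c P s) ^ 2) (S n)).
  - rewrite tech5; apply Rplus_le_compat.
    + apply Req_le, sum_eq; intros s Hs; rewrite E1, Cmod_mult, Hu by lia; ring.
    + apply pow_incr; split; [nra|exact E3].
  - apply sum_f_R0_le_more; [intros; apply pow2_ge_0|lia]. }
assert (L2 : sum_f_R0 (fun j => Cmod (P j) ^ 2) T = 1 + (x * mu) ^ 2 + S0).
{ unfold T; rewrite sum_split, tech5, sum_first, P0, Hu, Pmid.
  - rewrite Cmod_mult, Cmod_conj, Cmod_pos_real by lra; fold x.
    f_equal; [ring|]; unfold S0; rewrite <- sum_rev; apply sum_eq; intros i Hi.
    rewrite Phigh, Cmod_conj by (unfold T; lia); do 3 f_equal; unfold T; lia.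
  - intros i Hi; rewrite Plow, Cmod_0 by lia; ring. }
rewrite L2 in Main.
assert (0 <= x ^ 2 * mu) by (apply Rmult_le_pos; [apply pow2_ge_0|lra]).
enough (S0 + x ^ 2 * mu + b <= 1) by lra.
nra.
Qed.

(** Each step takes in two coefficients, [c_(2N+1)] and [c_(2N+2)], but one new square
    [|c_(N+1)|^2]; hence the ranges [2 * N] and [N]. The subtracted term is the tail that would
    result if all later coefficients had modulus [1 - sum |c_i|^2]. In the weight of the second sum,
    [1/(1+a)] is paid for by the gain in [carlson_even] and [x/(1-x)] by the shrinking of this
    tail. *)
Lemma schur_partial_bound q c x N : schur_sequence q c -> 0 <= x < 1 ->
  let a := Cmod (c 0%nat) in
  sum_f_R0 (fun i => Cmod (c i) * x ^ i) (2 * N)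
  + (1 / (1 + a) + x / (1 - x)) * sum_f_R0 (fun i => Cmod (c i) ^ 2 * x ^ (2 * i)) N
  <= (2 * a ^ 2 + a) / (1 + a) + x / (1 - x)
     - (1 - sum_f_R0 (fun i => Cmod (c i) ^ 2) N) * (x ^ (2 * N + 1) / (1 - x)).
Proof.
intros Hc Hx a; assert (Ha : 0 <= a) by apply Cmod_ge_0.
induction N as [|N IH].
(* Equality holds here: the constant [(2a^2+a)/(1+a)] is [a + a^2/(1+a)], the share of [c_0]. *)
- simpl; fold a; apply Req_le; field; lra.
- replace (2 * S N)%nat with (S (S (2 * N))) by lia.
  rewrite !tech5.
  pose proof (carlson_odd q c N Hc) as H1.
  pose proof (carlson_even q c N Hc) as H2; fold a in H2.
  replace (2 * N + 1)%nat with (S (2 * N)) in * by lia.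
  replace (2 * N + 2)%nat with (S (S (2 * N))) in * by lia.
  replace (S (S (2 * N)) + 1)%nat with (S (S (S (2 * N)))) by lia.
  set (U := sum_f_R0 (fun i => Cmod (c i) * x ^ i) (2 * N)) in *.
  set (V := sum_f_R0 (fun i => Cmod (c i) ^ 2 * x ^ (2 * i)) N) in *.
  set (W := sum_f_R0 (fun i => Cmod (c i) ^ 2) N) in *.
  set (c1 := Cmod (c (S (2 * N)))) in *.
  set (c2 := Cmod (c (S (S (2 * N))))) in *.
  set (y := Cmod (c (S N)) ^ 2) in *.
  set (X := x ^ (2 * N)) in *.
  replace (2 * S N)%nat with (S (S (2 * N))) by lia.
  change (x ^ S (2 * N)) with (x * X) in *.
  change (x ^ S (S (2 * N))) with (x * (x * X)) in *.
  change (x ^ S (S (S (2 * N)))) with (x * (x * (x * X))) in *.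
  assert (HX : 0 <= X) by (apply pow_le; lra).
  assert (K1 : c1 * (x * X) <= (1 - W) * (x * X)).
  { apply Rmult_le_compat_r; [apply Rmult_le_pos|]; lra. }
  assert (K2 : c2 * (x * (x * X)) <= (1 - W - y / (1 + a)) * (x * (x * X))).
  { apply Rmult_le_compat_r; [repeat apply Rmult_le_pos|]; lra. }
  (* The new right-hand side is exactly the old one plus the bounds of [K1] and [K2] and the new
     weighted square, so nothing is lost beyond Carlson's inequalities. *)
  replace ((2 * a ^ 2 + a) / (1 + a) + x / (1 - x)
           - (1 - (W + y)) * (x * (x * (x * X)) / (1 - x)))
    with ((2 * a ^ 2 + a) / (1 + a) + x / (1 - x) - (1 - W) * (x * X / (1 - x))
          + (1 - W) * (x * X) + (1 - W - y / (1 + a)) * (x * (x * X))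
          + (1 / (1 + a) + x / (1 - x)) * (y * (x * (x * X)))) by (field; lra).
  lra.
Qed.

Lemma schur_sum_le_1 q c n : schur_sequence q c ->
  sum_f_R0 (fun i => Cmod (c i) ^ 2) n <= 1.
Proof.
intros Hc; pose proof (carlson_odd q c n Hc); pose proof (Cmod_ge_0 (c (2 * n + 1)%nat)); lra.
Qed.

Lemma ex_series_bounded (u : nat -> R) B : (forall i, 0 <= u i) ->
  (forall n, sum_f_R0 u n <= B) -> ex_series u.
Proof.
intros Hu HB; destruct (ex_finite_lim_seq_incr (sum_n u) B) as (l & Hl).
- intros n; rewrite sum_Sn; unfold plus; simpl; specialize (Hu (S n)); lra.
- intros n; rewrite sum_n_Reals; apply HB.
- now exists l.
Qed.

Lemma schur_series_bound q c x : schur_sequence q c -> 0 <= x < 1 ->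
  let a := Cmod (c 0%nat) in
  exists U V,
    is_series (fun i => Cmod (c i) * x ^ i) U /\
    is_series (fun i => Cmod (c i) ^ 2 * x ^ (2 * i)) V /\
    U + (1 / (1 + a) + x / (1 - x)) * V <= (2 * a ^ 2 + a) / (1 + a) + x / (1 - x).
Proof.
intros Hc Hx a; assert (Ha : 0 <= a) by apply Cmod_ge_0.
set (k := 1 / (1 + a) + x / (1 - x)).
set (B := (2 * a ^ 2 + a) / (1 + a) + x / (1 - x)).
set (u := fun i => Cmod (c i) * x ^ i).
set (v := fun i => Cmod (c i) ^ 2 * x ^ (2 * i)).
assert (Hu : forall i, 0 <= u i).
{ intros i; apply Rmult_le_pos; [apply Cmod_ge_0|apply pow_le; lra]. }
assert (Hv : forall i, 0 <= v i).
{ intros i; apply Rmult_le_pos; [apply pow2_ge_0|apply pow_le; lra]. }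
assert (Hk : 0 < k).
{ assert (0 < 1 / (1 + a)) by (apply Rdiv_lt_0_compat; lra).
  assert (0 <= x / (1 - x)) by (apply Rdiv_le_0_compat; lra). unfold k; lra. }
assert (Hn : forall n, sum_f_R0 u n + k * sum_f_R0 v n <= B).
{ intros n; pose proof (schur_partial_bound q c x n Hc Hx) as H; cbv zeta in H.
  fold a u v k B in H.
  (* Shortening the first sum from [2 * n] to [n] gives both sums one index, along which the limit
     is taken. *)
  pose proof (sum_f_R0_le_more u n (2 * n) Hu ltac:(lia)).
  pose proof (schur_sum_le_1 q c n Hc) as H1.
  assert (0 <= (1 - sum_f_R0 (fun i => Cmod (c i) ^ 2) n) * (x ^ (2 * n + 1) / (1 - x))).
  { apply Rmult_le_pos; [lra|]; apply Rdiv_le_0_compat; [apply pow_le; lra|lra]. }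
  lra. }
assert (Ku : forall n, 0 <= sum_f_R0 u n) by (intros; now apply cond_pos_sum).
assert (Kv : forall n, 0 <= sum_f_R0 v n) by (intros; now apply cond_pos_sum).
destruct (ex_series_bounded u B Hu) as (U & HU).
{ intros n; specialize (Hn n); specialize (Kv n); nra. }
destruct (ex_series_bounded v (B / k) Hv) as (V & HV).
{ intros n; specialize (Hn n); specialize (Ku n).
  apply Rmult_le_reg_l with k; [lra|]; replace (k * (B / k)) with B by (field; lra); lra. }
exists U, V; split; [exact HU|split; [exact HV|]].
apply (is_lim_seq_le (fun n => sum_n u n + k * sum_n v n) (fun _ => B) (U + k * V) B).
- intros n; rewrite !sum_n_Reals; apply Hn.
- apply is_lim_seq_plus'; [exact HU|].
  apply (is_lim_seq_scal_l _ k V); exact HV.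
- apply is_lim_seq_const.
Qed.

(** * The majorant of M and the radius *)

Lemma nonneg_sum_eval (t : nat -> R) (l : R) : is_series t l -> nonneg_sum t = Finite l.
Proof. intros H; apply is_lim_seq_unique; exact H. Qed.

Lemma M_eval k p m (ca : nat -> C) (r U V : R) :
  let c := fun i => ca (p * (k + i) + m)%nat in
  is_series (fun i => Cmod (c i) * (r ^ p) ^ i) U ->
  is_series (fun i => Cmod (c i) ^ 2 * (r ^ p) ^ (2 * i)) V ->
  M k p m ca r = Finite (r ^ (p * k + m) *
    (U + (1 / (1 + Cmod (c 0%nat)) + r ^ p / (1 - r ^ p)) * V)).
Proof.
intros c HU HV; unfold M.
rewrite (nonneg_sum_eval _ (U * r ^ (p * k + m))), (nonneg_sum_eval _ (V * r ^ (p * k + m))).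
- simpl; unfold c; rewrite Nat.add_0_r; f_equal; ring.
- apply (is_series_scal_r (r ^ (p * k + m))) in HV; revert HV; apply is_series_ext; intros i.
  replace (2 * (k + i) - k)%nat with (k + 2 * i)%nat by lia.
  replace (p * (k + 2 * i) + m)%nat with ((p * k + m) + p * (2 * i))%nat by ring.
  rewrite (pow_add r (p * k + m)), (pow_mult r p); unfold c; refine (_ : @eq R _ _); ring.
- apply (is_series_scal_r (r ^ (p * k + m))) in HU; revert HU; apply is_series_ext; intros i.
  replace (p * (k + i) + m)%nat with ((p * k + m) + p * i)%nat at 2 by ring.
  rewrite (pow_add r (p * k + m)), (pow_mult r p); unfold c; refine (_ : @eq R _ _); ring.
Qed.

Definition M_sup (k p m : nat) (a r : R) : R :=
  r ^ (p * k + m) * ((2 * a ^ 2 + a) / (1 + a) + r ^ p / (1 - r ^ p)).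

Lemma pow_lt_1 r p : 0 <= r < 1 -> (1 <= p)%nat -> 0 <= r ^ p < 1.
Proof.
intros Hr Hp; split; [apply pow_le; lra|].
rewrite <- (pow1 p); destruct p as [|p]; [lia|].
rewrite pow1; simpl; assert (r ^ p <= 1) by (rewrite <- (pow1 p); apply pow_incr; lra).
assert (0 <= r ^ p) by (apply pow_le; lra); nra.
Qed.

(** Finiteness is recorded along with the bound so that the extended-real inequality for the sum of
    two such values can be read in the reals. *)
Lemma M_le_sup q k p m (ca : nat -> C) r :
  schur_sequence q (fun i => ca (p * (k + i) + m)%nat) -> 0 <= r < 1 -> (1 <= p)%nat ->
  Rbar_le (M k p m ca r) (M_sup k p m (Cmod (ca (p * k + m)%nat)) r) /\
  is_finite (M k p m ca r).
Proof.
intros Hc Hr Hp.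
destruct (schur_series_bound q _ (r ^ p) Hc (pow_lt_1 r p Hr Hp)) as (U & V & HU & HV & H).
rewrite (M_eval k p m ca r U V HU HV); rewrite Nat.add_0_r in *.
split; [|reflexivity].
apply Rmult_le_compat_l; [apply pow_le; lra|exact H].
Qed.

Lemma pow_lt_compat r s n : 0 <= r < s -> (1 <= n)%nat -> r ^ n < s ^ n.
Proof.
intros H Hn; destruct n as [|n]; [lia|]; simpl.
assert (r ^ n <= s ^ n) by (apply pow_incr; lra).
assert (0 < s ^ n) by (apply pow_lt; lra).
assert (0 <= r ^ n) by (apply pow_le; lra); nra.
Qed.

Lemma M_sup_increasing k p m a r s : (1 <= p)%nat -> (1 <= m)%nat -> 0 < a ->
  0 <= r < s -> s < 1 -> M_sup k p m a r < M_sup k p m a s.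
Proof.
intros Hp Hm Ha Hrs Hs; unfold M_sup.
pose proof (pow_lt_1 r p ltac:(lra) Hp) as Rp.
pose proof (pow_lt_1 s p ltac:(lra) Hp) as Sp.
pose proof (pow_lt_compat r s p Hrs Hp) as RS.
pose proof (pow_lt_compat r s (p * k + m) Hrs ltac:(lia)) as RSn.
assert (0 <= r ^ (p * k + m)) by (apply pow_le; lra).
assert (0 < (2 * a ^ 2 + a) / (1 + a)) by (apply Rdiv_lt_0_compat; nra).
assert (Q : r ^ p / (1 - r ^ p) <= s ^ p / (1 - s ^ p)).
{ apply Rmult_le_compat; try lra; [left; apply Rinv_0_lt_compat; lra|].
  apply Rinv_le_contravar; lra. }
assert (0 <= r ^ p / (1 - r ^ p)) by (apply Rdiv_le_0_compat; lra).
set (A := (2 * a ^ 2 + a) / (1 + a)) in *.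
apply Rle_lt_trans with (r ^ (p * k + m) * (A + s ^ p / (1 - s ^ p))).
- apply Rmult_le_compat_l; lra.
- apply Rmult_lt_compat_r; lra.
Qed.

(** The left side of the radius equation is [1 - 2 * M_sup] multiplied by the positive factor
    [(1 + a) * (1 - r ^ p)]. *)
Lemma is_radius_iff k p m a r : (1 <= p)%nat -> 0 < a -> 0 < r < 1 ->
  is_radius k p m a r <-> 2 * M_sup k p m a r = 1.
Proof.
intros Hp Ha Hr; pose proof (pow_lt_1 r p ltac:(lra) Hp) as Rp.
assert (E : (1 + a) * (1 - r ^ p)
    - 2 * r ^ (p * k + m) * (2 * a ^ 2 + a + r ^ p * (1 - 2 * a ^ 2))
    = (1 + a) * (1 - r ^ p) * (1 - 2 * M_sup k p m a r)).
{ unfold M_sup; field; lra. }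
assert (0 < (1 + a) * (1 - r ^ p)) by (apply Rmult_lt_0_compat; lra).
unfold is_radius; rewrite E; split.
- intros [_ H0]; apply Rmult_integral in H0; destruct H0; lra.
- intros ->; split; [assumption|ring].
Qed.

(** The polynomial form of the equation, unlike [M_sup], has no pole at 1; with the sign reversed it
    equals [-(1 + a)] at 0 and [2 * (1 + a)] at 1. *)
Lemma radius_exists k p m a : (1 <= p)%nat -> (1 <= m)%nat -> 0 < a ->
  exists s, is_radius k p m a s.
Proof.
intros Hp Hm Ha.
set (g := fun r => 2 * r ^ (p * k + m) * (2 * a ^ 2 + a + r ^ p * (1 - 2 * a ^ 2))
                   - (1 + a) * (1 - r ^ p)).
assert (g0 : g 0 < 0) by (unfold g; rewrite !pow_i by lia; nra).
assert (g1 : 0 < g 1) by (unfold g; rewrite !pow1; nra).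
destruct (IVT g 0 1 ltac:(unfold g; reg) Rlt_0_1 g0 g1) as (s & Hs & Es).
exists s; split.
- split; apply Rnot_le_lt; intros H.
  + replace s with 0 in Es by lra; lra.
  + replace s with 1 in Es by lra; lra.
- unfold g in Es; lra.
Qed.

Lemma radius_unique k p m a r s : (1 <= p)%nat -> (1 <= m)%nat -> 0 < a ->
  is_radius k p m a r -> is_radius k p m a s -> r = s.
Proof.
intros Hp Hm Ha Hr Hs; pose proof (proj1 Hr) as Ir; pose proof (proj1 Hs) as Is.
apply is_radius_iff in Hr; [|assumption..].
apply is_radius_iff in Hs; [|assumption..].
destruct (Rtotal_order r s) as [H|[H|H]]; [|exact H|].
- pose proof (M_sup_increasing k p m a r s Hp Hm Ha ltac:(lra) ltac:(lra)); lra.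
- pose proof (M_sup_increasing k p m a s r Hp Hm Ha ltac:(lra) ltac:(lra)); lra.
Qed.

(** A point [w = r e^(it)] is [z^p] for [z = r^(1/p) e^(it/p)], and the series at [w] sums to
    [h(z) / z^(pk+m)]. The weight [r^(pk+m)] absorbs the denominator because [r = |z|^p <= |z|]. *)
Lemma expansion_schur k p m (ca : nat -> C) (h : C -> C) : (1 <= p)%nat ->
  has_expansion k p m ca h -> class_B h ->
  schur_sequence (p * k + m) (fun i => ca (p * (k + i) + m)%nat).
Proof.
intros Hp Hh [_ Hb] r t Hr.
assert (Ip : 0 < INR p) by (apply lt_0_INR; lia).
set (y := Rpower r (/ INR p)).
assert (Hy : 0 < y) by apply exp_pos.
assert (Hyp : y ^ p = r).
{ rewrite <- Rpower_pow by exact Hy; unfold y.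
  rewrite Rpower_mult, Rinv_l, Rpower_1 by lra; reflexivity. }
assert (Hy1 : y < 1).
{ apply Rnot_le_lt; intros H; assert (1 <= y ^ p) by (apply pow_R1_Rle; lra); lra. }
set (z := Cmult y (cis (t / INR p))).
assert (Hz : Cmod z = y) by (unfold z; rewrite Cmod_mult, cis_mod, Cmod_R, Rabs_pos_eq; lra).
assert (Hzp : Cpow z p = Cmult r (cis t)).
{ unfold z; rewrite Cpow_mult_l, <- RtoC_pow, Hyp, cis_pow; do 2 f_equal; field; lra. }
assert (Hzn : Cpow z (p * k + m) <> 0).
{ apply Cpow_nz; intros E; rewrite E, Cmod_0 in Hz; lra. }
assert (Dz : in_disk z) by (unfold in_disk; lra).
exists (Cdiv (h z) (Cpow z (p * k + m))); split.
- pose proof (is_series_scal (V := C_NormedModule) (Cinv (Cpow z (p * k + m))) _ _ (Hh z Dz))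
    as H.
  replace (Cdiv (h z) (Cpow z (p * k + m))) with (Cmult (Cinv (Cpow z (p * k + m))) (h z))
    by (unfold Cdiv; ring).
  revert H; apply is_series_ext; intros i; unfold scal; simpl; unfold mult; simpl.
  replace (Cpow z (p * (k + i) + m)) with (Cmult (Cpow z (p * k + m)) (Cpow (Cpow z p) i)).
  + rewrite Hzp; set (w := Cpow (Cmult _ _) i); field; exact Hzn.
  + rewrite <- Cpow_mult_r, <- Cpow_add_r; f_equal; ring.
- rewrite Cmod_div, Cmod_pow, Hz by exact Hzn.
  assert (Y : 0 < y ^ (p * k + m)) by (apply pow_lt; lra).
  apply Rmult_le_reg_r with (y ^ (p * k + m)); [exact Y|].
  replace (r ^ (p * k + m) * (Cmod (h z) / y ^ (p * k + m)) * y ^ (p * k + m))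
    with (r ^ (p * k + m) * Cmod (h z)) by (field; lra).
  assert (r <= y).
  { rewrite <- Hyp; destruct p as [|p']; [lia|]; simpl.
    assert (y ^ p' <= 1) by (rewrite <- (pow1 p'); apply pow_incr; lra); nra. }
  assert (r ^ (p * k + m) <= y ^ (p * k + m)) by (apply pow_incr; lra).
  assert (0 <= r ^ (p * k + m)) by (apply pow_le; lra).
  pose proof (Hb z Dz); pose proof (Cmod_ge_0 (h z)); nra.
Qed.

(** * Smooth complex functions *)

Definition C_is_derive (f : C -> C) (z l : C) : Prop :=
  @is_derive C_AbsRing C_NormedModule f z l.

Lemma C_is_derive_eps f z l :
  C_is_derive f z l <->
  (forall eps, 0 < eps -> exists d, 0 < d /\ forall y, Cmod (Cminus y z) < d ->
     Cmod (Cminus (Cminus (f y) (f z)) (Cmult (Cminus y z) l)) <= eps * Cmod (Cminus y z)).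
Proof.
split.
- intros [_ H] eps Heps.
  destruct (H z (fun P HP => HP) (mkposreal eps Heps)) as [d Hd].
  exists d; split; [apply cond_pos|]; intros y Hy; exact (Hd y Hy).
- intros H; split; [apply is_linear_scal_l|].
  intros x Hx eps.
  apply (@is_filter_lim_locally_unique C_AbsRing) in Hx; subst x.
  destruct (H eps (cond_pos eps)) as (d & Hd & Hy).
  exists (mkposreal d Hd); intros y Hb; exact (Hy y Hb).
Qed.

(* [C_NormedModule] and [C_AbsRing] put differently built, though equivalent,
   uniform structures on [C]. *)
Lemma C_is_derive_AbsRing f z l :
  C_is_derive f z l <-> @is_derive C_AbsRing (AbsRing_NormedModule C_AbsRing) f z l.
Proof.
split; intros [[L1 L2 L3] H]; (split; [split; [exact L1|exact L2|exact L3]|exact H]).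
Qed.

Lemma C_is_derive_const (c z : C) : C_is_derive (fun _ => c) z 0.
Proof. exact (@is_derive_const C_AbsRing C_NormedModule c z). Qed.

Lemma C_is_derive_id z : C_is_derive (fun x => x) z 1.
Proof. apply C_is_derive_AbsRing; exact (@is_derive_id C_AbsRing z). Qed.

Lemma C_is_derive_plus f g z l k : C_is_derive f z l -> C_is_derive g z k ->
  C_is_derive (fun x => Cplus (f x) (g x)) z (Cplus l k).
Proof. exact (@is_derive_plus C_AbsRing C_NormedModule f g z l k). Qed.

Lemma C_is_derive_mult f g z l k : C_is_derive f z l -> C_is_derive g z k ->
  C_is_derive (fun x => Cmult (f x) (g x)) z (Cplus (Cmult l (g z)) (Cmult (f z) k)).
Proof.
rewrite !C_is_derive_AbsRing; intros Hf Hg.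
exact (@is_derive_mult C_AbsRing f g z l k Hf Hg Cmult_comm).
Qed.

Lemma C_is_derive_Cinv (z : C) : z <> 0 ->
  C_is_derive Cinv z (Copp (Cmult (Cinv z) (Cinv z))).
Proof.
intros Hz.
assert (Pz : 0 < Cmod z) by now apply Cmod_gt_0.
apply C_is_derive_eps; intros eps Heps.
(* The remainder is [(y-z)^2 / (y z^2)]. The first bound gives [|y| > |z|/2], so the denominator has
   modulus at least [|z|^3 / 2], and the second bound does the rest. *)
exists (Rmin (Cmod z / 2) (eps * Cmod z ^ 3 / 2)); split.
- apply Rmin_glb_lt; [lra|]; apply Rdiv_lt_0_compat; [|lra].
  apply Rmult_lt_0_compat; [lra|now apply pow_lt].
- intros y Hy.
  assert (Hy1 : Cmod (Cminus y z) < Cmod z / 2) by (eapply Rlt_le_trans; [exact Hy|apply Rmin_l]).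
  assert (Hy2 : Cmod (Cminus y z) < eps * Cmod z ^ 3 / 2)
    by (eapply Rlt_le_trans; [exact Hy|apply Rmin_r]).
  assert (Py : Cmod z / 2 < Cmod y).
  { pose proof (Cmod_triangle y (Copp (Cminus y z))) as T; rewrite Cmod_opp in T.
    replace (Cplus y (Copp (Cminus y z))) with z in T by ring; lra. }
  assert (Hy0 : y <> 0) by (apply Cmod_gt_0; lra).
  replace (Cminus (Cminus (Cinv y) (Cinv z)) (Cmult (Cminus y z) (Copp (Cmult (Cinv z) (Cinv z)))))
    with (Cmult (Cminus y z) (Cmult (Cminus y z) (Cinv (Cmult y (Cmult z z)))))
    by (field; repeat split; assumption).
  rewrite Cmod_mult, Rmult_comm; apply Rmult_le_compat_r; [apply Cmod_ge_0|].
  rewrite Cmod_mult, Cmod_inv, !Cmod_mult by (repeat apply Cmult_neq_0; assumption).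
  set (u := Cmod (Cminus y z)) in *; set (v := Cmod y) in *; set (w := Cmod z) in *.
  assert (V : 0 < v * (w * w)) by (apply Rmult_lt_0_compat; nra).
  apply Rmult_le_reg_r with (v * (w * w)); [exact V|].
  rewrite Rmult_assoc, Rinv_l, Rmult_1_r by lra.
  left; eapply Rlt_le_trans; [exact Hy2|].
  replace (eps * w ^ 3 / 2) with (eps * (w / 2 * (w * w))) by field.
  apply Rmult_le_compat_l; [lra|]; apply Rmult_le_compat_r; nra.
Qed.

Lemma C_is_derive_inv (g : C -> C) (z l : C) : g z <> 0 -> C_is_derive g z l ->
  C_is_derive (fun x => Cinv (g x)) z
    (Cmult l (Copp (Cmult (Cinv (g z)) (Cinv (g z))))).
Proof.
intros Hz Hg; apply C_is_derive_AbsRing in Hg; apply C_is_derive_Cinv in Hz.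
exact (@is_derive_comp C_AbsRing C_NormedModule Cinv g z _ _ Hz Hg).
Qed.

Lemma C_is_derive_ext_disk f g z l : in_disk z ->
  (forall x, in_disk x -> f x = g x) -> C_is_derive f z l -> C_is_derive g z l.
Proof.
intros Hz Hfg; apply (@is_derive_ext_loc C_AbsRing C_NormedModule).
unfold in_disk in *.
enough (H : forall y : C, Cmod (Cminus y z) < 1 - Cmod z -> f y = g y).
{ exists (mkposreal (1 - Cmod z) ltac:(lra)); exact H. }
intros y Hy; apply Hfg.
pose proof (Cmod_triangle (Cminus y z) z) as T.
replace (Cplus (Cminus y z) z) with y in T by ring; lra.
Qed.

(** Each order supplies its derivative as a witness, so that closure under sums, products and
    inverses yields the higher derivatives of the extremal function without Cauchy's theory. *)
Fixpoint C_smooth (n : nat) (f : C -> C) : Prop :=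
  match n with
  | O => True
  | S n => exists f', (forall z, in_disk z -> C_is_derive f z (f' z)) /\ C_smooth n f'
  end.

Lemma C_smooth_le n f : C_smooth (S n) f -> C_smooth n f.
Proof.
revert f; induction n as [|n IH]; intros f H; [exact I|].
destruct H as (f' & Hf & H); exists f'; split; [exact Hf|now apply IH].
Qed.

Lemma C_smooth_const n c : C_smooth n (fun _ => c).
Proof.
revert c; induction n as [|n IH]; intros c; [exact I|].
exists (fun _ => RtoC 0); split; [intros; apply C_is_derive_const|apply IH].
Qed.

Lemma C_smooth_id n : C_smooth n (fun z => z).
Proof.
destruct n as [|n]; [exact I|].
exists (fun _ => RtoC 1); split; [intros; apply C_is_derive_id|apply C_smooth_const].
Qed.

Lemma C_smooth_plus n f g : C_smooth n f -> C_smooth n g ->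
  C_smooth n (fun z => Cplus (f z) (g z)).
Proof.
revert f g; induction n as [|n IH]; intros f g Hf Hg; [exact I|].
destruct Hf as (f' & Df & Hf), Hg as (g' & Dg & Hg).
exists (fun z => Cplus (f' z) (g' z)); split; [|now apply IH].
intros z Hz; apply C_is_derive_plus; auto.
Qed.

Lemma C_smooth_mult n f g : C_smooth n f -> C_smooth n g ->
  C_smooth n (fun z => Cmult (f z) (g z)).
Proof.
revert f g; induction n as [|n IH]; intros f g Hf Hg; [exact I|].
pose proof (C_smooth_le _ _ Hf) as Hf0; pose proof (C_smooth_le _ _ Hg) as Hg0.
destruct Hf as (f' & Df & Hf), Hg as (g' & Dg & Hg).
exists (fun z => Cplus (Cmult (f' z) (g z)) (Cmult (f z) (g' z))); split.
- intros z Hz; apply C_is_derive_mult; auto.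
- apply C_smooth_plus; now apply IH.
Qed.

Lemma C_smooth_opp n f : C_smooth n f -> C_smooth n (fun z => Copp (f z)).
Proof.
revert f; induction n as [|n IH]; intros f Hf; [exact I|].
destruct Hf as (f' & Df & Hf).
exists (fun z => Copp (f' z)); split; [|now apply IH].
intros z Hz; exact (@is_derive_opp C_AbsRing C_NormedModule f z _ (Df z Hz)).
Qed.

Lemma C_smooth_pow n j : C_smooth n (fun z => Cpow z j).
Proof.
induction j as [|j IH]; [exact (C_smooth_const n 1)|].
exact (C_smooth_mult n _ _ (C_smooth_id n) IH).
Qed.

Lemma C_smooth_inv n (g : C -> C) : (forall z, in_disk z -> g z <> 0) -> C_smooth n g ->
  C_smooth n (fun z => Cinv (g z)).
Proof.
intros H0; induction n as [|n IH]; intros Hg; [exact I|].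
pose proof (IH (C_smooth_le _ _ Hg)) as Hi.
destruct Hg as (g' & Dg & Hg).
exists (fun z => Cmult (g' z) (Cmult (Copp 1) (Cmult (Cinv (g z)) (Cinv (g z))))); split.
- intros z Hz.
  replace (Cmult (Copp 1) (Cmult (Cinv (g z)) (Cinv (g z))))
    with (Copp (Cmult (Cinv (g z)) (Cinv (g z)))).
  + apply C_is_derive_inv; auto.
  + ring.
- repeat apply C_smooth_mult; auto using C_smooth_const.
Qed.

(** Since [(z^(M+1) q)' = z^M ((M+1) q + z q')], a derivative costs one power of [z] and one order
    of smoothness of the cofactor. All derivatives of order below [N] thus vanish at 0. *)
Lemma C_derive_n_pow_mult N (q h : C -> C) : C_smooth N q ->
  (forall z, in_disk z -> h z = Cmult (Cpow z N) (q z)) ->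
  forall j, (j <= N)%nat -> exists qj, C_smooth (N - j) qj /\
    forall z, in_disk z -> C_derive_n j h z = Cmult (Cpow z (N - j)) (qj z).
Proof.
intros Hq Hh; induction j as [|j IH]; intros Hj.
- exists q; rewrite Nat.sub_0_r; split; assumption.
- destruct IH as (qj & Sq & Hqj); [lia|].
  replace (N - j)%nat with (S (N - S j)) in * by lia.
  set (M := (N - S j)%nat) in *.
  pose proof (C_smooth_le _ _ Sq) as Sq0.
  destruct Sq as (q' & Dq & Sq').
  assert (Dpow : forall K z, C_is_derive (fun x => Cpow x (S K)) z
                                (Cmult (INR (S K)) (Cpow z K))).
  { intros K z; induction K as [|K IHK].
    - replace (Cmult (INR 1) (Cpow z 0)) with (Cplus (Cmult 1 (Cpow z 0)) (Cmult z 0)).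
      + apply C_is_derive_mult; [apply C_is_derive_id|apply C_is_derive_const].
      + simpl; ring.
    - replace (Cmult (INR (S (S K))) (Cpow z (S K))) with
        (Cplus (Cmult 1 (Cpow z (S K))) (Cmult z (Cmult (INR (S K)) (Cpow z K)))).
      + apply C_is_derive_mult; [apply C_is_derive_id|exact IHK].
      + rewrite (S_INR (S K)), RtoC_plus, Cpow_S; ring. }
  exists (fun z => Cplus (Cmult (INR (S M)) (qj z)) (Cmult z (q' z))); split.
  + apply C_smooth_plus; apply C_smooth_mult; auto using C_smooth_const, C_smooth_id.
  + intros z Hz; apply is_C_derive_unique.
    change (C_is_derive (C_derive_n j h) z
      (Cmult (Cpow z M) (Cplus (Cmult (INR (S M)) (qj z)) (Cmult z (q' z))))).
    apply (C_is_derive_ext_disk (fun x => Cmult (Cpow x (S M)) (qj x))); [exact Hz| |].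
    * intros x Hx; symmetry; now apply Hqj.
    * replace (Cmult (Cpow z M) (Cplus (Cmult (INR (S M)) (qj z)) (Cmult z (q' z))))
        with (Cplus (Cmult (Cmult (INR (S M)) (Cpow z M)) (qj z)) (Cmult (Cpow z (S M)) (q' z)))
        by (rewrite Cpow_S; ring).
      apply C_is_derive_mult; [apply Dpow|now apply Dq].
Qed.

(** * Real parts as functions of two real variables *)

Lemma C_is_derive_dir f (z l v kappa : C) (t0 : R) : C_is_derive f z l -> Cmod v = 1 ->
  is_derive (fun t : R => Re (Cmult kappa (f (Cplus z (Cmult (t - t0)%R v))))) t0
            (Re (Cmult kappa (Cmult v l))).
Proof.
intros H Hv; split; [apply is_linear_scal_l|].
intros x Hx eps; apply (@is_filter_lim_locally_unique R_AbsRing) in Hx; subst x.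
assert (He : 0 < eps / (Cmod kappa + 1)).
{ apply Rdiv_lt_0_compat; [apply cond_pos|pose proof (Cmod_ge_0 kappa); lra]. }
destruct (proj1 (C_is_derive_eps _ _ _) H _ He) as (d & Hd & Hy).
exists (mkposreal d Hd); intros t Ht.
change (Rabs (t - t0) < d) in Ht.
change (Rabs (Re (Cmult kappa (f (Cplus z (Cmult (t - t0)%R v))))
   - Re (Cmult kappa (f (Cplus z (Cmult (t0 - t0)%R v))))
   - (t - t0) * Re (Cmult kappa (Cmult v l))) <= eps * Rabs (t - t0)).
replace (t0 - t0) with 0 by ring.
replace (Cplus z (Cmult 0 v)) with z by ring.
set (s := t - t0) in *.
specialize (Hy (Cplus z (Cmult s v))).
replace (Cminus (Cplus z (Cmult s v)) z) with (Cmult s v) in Hy by ring.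
rewrite Cmod_mult, Hv, Cmod_R, Rmult_1_r in Hy; specialize (Hy Ht).
set (D := Cminus _ _) in Hy.
replace (Re (Cmult kappa (f (Cplus z (Cmult s v)))) - Re (Cmult kappa (f z))
         - s * Re (Cmult kappa (Cmult v l))) with (Re (Cmult kappa D)).
- eapply Rle_trans; [apply re_le_Cmod|]; rewrite Cmod_mult.
  pose proof (Cmod_ge_0 kappa) as Hk.
  apply Rle_trans with (Cmod kappa * (eps / (Cmod kappa + 1) * Rabs s)).
  + apply Rmult_le_compat_l; assumption.
  + replace (eps * Rabs s) with ((Cmod kappa + 1) * (eps / (Cmod kappa + 1) * Rabs s))
      by (field; lra).
    apply Rmult_le_compat_r; [|lra].
    apply Rmult_le_pos; [lra|apply Rabs_pos].
- unfold D; destruct kappa, v, l, (f z), (f (Cplus z _)); simpl; ring.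
Qed.

Lemma Cmod_le_Rabs (x y : R) : Cmod (x, y) <= Rabs x + Rabs y.
Proof.
replace ((x, y) : C) with (Cplus x (Cmult Ci y)).
- eapply Rle_trans; [apply Cmod_triangle|].
  rewrite Cmod_mult, Cmod_Ci, !Cmod_R; lra.
- unfold Cplus, Cmult, Ci, RtoC; simpl; f_equal; ring.
Qed.

Lemma in_disk_open x y : in_disk (x, y) -> exists d : posreal, forall u v,
  Rabs (u - x) < d -> Rabs (v - y) < d -> in_disk (u, v).
Proof.
unfold in_disk; intros H.
exists (mkposreal ((1 - Cmod (x, y)) / 2) ltac:(lra)); simpl; intros u v Hu Hv.
pose proof (Cmod_triangle (x, y) (u - x, v - y)%R) as T.
replace (Cplus (x, y) (u - x, v - y)%R) with ((u, v) : C) in T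
  by (unfold Cplus; simpl; f_equal; ring).
pose proof (Cmod_le_Rabs (u - x) (v - y)); lra.
Qed.

(** The factor [kappa] makes this class closed under partial derivatives: both replace [f] by [f'],
    and the one in y also turns [kappa] into [i kappa]. *)
Definition Re_part (u : R -> R -> R) (kappa : C) (f : C -> C) : Prop :=
  forall x y, in_disk (x, y) -> u x y = Re (Cmult kappa (f (x, y))).

Lemma Re_part_partial u kappa f f' x y :
  (forall z, in_disk z -> C_is_derive f z (f' z)) -> Re_part u kappa f -> in_disk (x, y) ->
  is_derive (fun t => u t y) x (Re (Cmult kappa (f' (x, y)))) /\
  is_derive (fun t => u x t) y (Re (Cmult (Cmult Ci kappa) (f' (x, y)))).
Proof.
intros Df Hu Hxy; destruct (in_disk_open x y Hxy) as [d Hd]; split.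
- apply is_derive_ext_loc with
    (fun t : R => Re (Cmult kappa (f (Cplus (x, y) (Cmult (t - x)%R 1))))).
  + exists d; intros t Ht; change (Rabs (t - x) < d) in Ht; rewrite Hu.
    * do 3 f_equal; unfold Cplus, Cmult, RtoC; simpl; f_equal; ring.
    * apply Hd; [exact Ht|]; replace (y - y) with 0 by ring; rewrite Rabs_R0; apply cond_pos.
  + rewrite <- (Cmult_1_l (f' (x, y))).
    apply C_is_derive_dir; [now apply Df|apply Cmod_1].
- apply is_derive_ext_loc with
    (fun t : R => Re (Cmult kappa (f (Cplus (x, y) (Cmult (t - y)%R Ci))))).
  + exists d; intros t Ht; change (Rabs (t - y) < d) in Ht; rewrite Hu.
    * do 3 f_equal; unfold Cplus, Cmult, RtoC, Ci; simpl; f_equal; ring.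
    * apply Hd; [|exact Ht]; replace (x - x) with 0 by ring; rewrite Rabs_R0; apply cond_pos.
  + rewrite (Cmult_comm Ci kappa), <- Cmult_assoc.
    apply C_is_derive_dir; [now apply Df|apply Cmod_Ci].
Qed.

Lemma Re_part_Derive u kappa f f' :
  (forall z, in_disk z -> C_is_derive f z (f' z)) -> Re_part u kappa f ->
  Re_part (fun x y => Derive (fun t => u t y) x) kappa f' /\
  Re_part (fun x y => Derive (fun t => u x t) y) (Cmult Ci kappa) f'.
Proof.
intros Df Hu; split; intros x y Hxy; apply is_derive_unique;
  now apply (Re_part_partial u kappa f f' x y Df Hu Hxy).
Qed.

Lemma Re_part_continuous u kappa f l x y :
  C_is_derive f (x, y) l -> Re_part u kappa f -> in_disk (x, y) -> continuity_2d_pt u x y.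
Proof.
intros Df Hu Hxy eps; destruct (in_disk_open x y Hxy) as [d0 Hd0].
(* Differentiability with error ratio 1 gives a local Lipschitz bound with constant [1 + |l|]. *)
destruct (proj1 (C_is_derive_eps _ _ _) Df 1 Rlt_0_1) as (d & Hd & Hf).
set (K := (Cmod kappa + 1) * (1 + Cmod l)).
pose proof (Cmod_ge_0 kappa) as Hk; pose proof (Cmod_ge_0 l) as Hl.
assert (HK : 0 < K) by (apply Rmult_lt_0_compat; lra).
assert (He : 0 < eps / K / 2).
{ apply Rdiv_lt_0_compat; [apply Rdiv_lt_0_compat; [apply cond_pos|exact HK]|lra]. }
set (d1 := Rmin d0 (Rmin (d / 2) (eps / K / 2))).
assert (Hd1 : 0 < d1) by (repeat apply Rmin_glb_lt; [apply cond_pos|lra|exact He]).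
assert (L0 : d1 <= d0) by apply Rmin_l.
assert (L1 : d1 <= d / 2) by (eapply Rle_trans; [apply Rmin_r|apply Rmin_l]).
assert (L2 : d1 <= eps / K / 2) by (eapply Rle_trans; [apply Rmin_r|apply Rmin_r]).
exists (mkposreal d1 Hd1); simpl; intros v w Hv Hw.
rewrite (Hu x y Hxy), (Hu v w) by (apply Hd0; lra).
assert (E : Cminus (v, w) (x, y) = (v - x, w - y)%R).
{ unfold Cminus, Cplus, Copp; simpl; f_equal; ring. }
pose proof (Cmod_le_Rabs (v - x) (w - y)) as Hm; rewrite <- E in Hm.
specialize (Hf (v, w) ltac:(lra)).
set (D := Cminus (v, w) (x, y)) in *.
assert (B : Cmod (Cminus (f (v, w)) (f (x, y))) <= (1 + Cmod l) * Cmod D).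
{ pose proof (Cmod_triangle (Cminus (Cminus (f (v, w)) (f (x, y))) (Cmult D l)) (Cmult D l)) as T.
  replace (Cplus (Cminus (Cminus (f (v, w)) (f (x, y))) (Cmult D l)) (Cmult D l))
    with (Cminus (f (v, w)) (f (x, y))) in T by ring.
  rewrite (Cmod_mult D l) in T; lra. }
replace (Re (Cmult kappa (f (v, w))) - Re (Cmult kappa (f (x, y))))
  with (Re (Cmult kappa (Cminus (f (v, w)) (f (x, y)))))
  by (destruct kappa, (f (v, w)), (f (x, y)); simpl; ring).
eapply Rle_lt_trans; [apply re_le_Cmod|]; rewrite Cmod_mult.
apply Rle_lt_trans with (K * Cmod D).
- unfold K; rewrite Rmult_assoc; apply Rmult_le_compat; try lra; apply Cmod_ge_0.
- apply Rlt_le_trans with (K * (eps / K)); [|right; field; lra].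
  apply Rmult_lt_compat_l; lra.
Qed.

(** The extra order of smoothness provides the continuity of the partial derivatives of order
    [n]. *)
Lemma C_smooth_ex_diff_n n : forall u kappa f, C_smooth (S n) f -> Re_part u kappa f ->
  forall x y, in_disk (x, y) -> ex_diff_n u n x y.
Proof.
induction n as [|n IH]; intros u kappa f (f' & Df & Sf) Hu x y Hxy.
- split; [|exact I]; now apply (Re_part_continuous u kappa f (f' (x, y))); [apply Df| |].
- split; [now apply (Re_part_continuous u kappa f (f' (x, y))); [apply Df| |]|].
  destruct (Re_part_partial u kappa f f' x y Df Hu Hxy) as [Dx Dy].
  destruct (Re_part_Derive u kappa f f' Df Hu) as [Ux Uy].
  split; [eexists; exact Dx|split; [eexists; exact Dy|split]].
  + exact (IH _ kappa f' Sf Ux x y Hxy).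
  + exact (IH _ (Cmult Ci kappa) f' Sf Uy x y Hxy).
Qed.

(** Differentiating twice in y multiplies [kappa] by [i^2 = -1], so the two second derivatives are
    opposite. *)
Lemma C_smooth_harmonic u kappa f : C_smooth 3 f -> Re_part u kappa f ->
  real_harmonic_on_disk u.
Proof.
intros Sf Hu x y Hxy; split; [now apply (C_smooth_ex_diff_n 2 u kappa f)|].
destruct Sf as (f1 & D1 & f2 & D2 & _).
destruct (Re_part_Derive u kappa f f1 D1 Hu) as [Ux Uy].
destruct (Re_part_Derive _ _ f1 f2 D2 Ux) as [Uxx _].
destruct (Re_part_Derive _ _ f1 f2 D2 Uy) as [_ Uyy].
change (Derive (fun t => Derive (fun s => u s y) t) x
        + Derive (fun t => Derive (fun s => u x s) t) y = 0).
rewrite (Uxx x y Hxy), (Uyy x y Hxy).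
destruct kappa, (f2 (x, y)); simpl; ring.
Qed.

(** * The extremal function *)

(** Taylor coefficients of [(a-w)/(1-aw)]. The coefficient of [w^(i+1)] carries [a^i], so the moduli
    after the first form a geometric sequence. *)
Definition mobius_coef (a : R) (i : nat) : R :=
  match i with O => a | S i => - (1 - a ^ 2) * a ^ i end.

Definition mobius (a : R) (w : C) : C := Cdiv (Cminus a w) (Cminus 1 (Cmult a w)).

Definition extremal (k p m : nat) (a : R) (z : C) : C :=
  Cmult (Cpow z (p * k + m)) (mobius a (Cpow z p)).

(** Coefficients are indexed by the exponent [n = p(k+i) + m]; the division recovers [i]. *)
Definition extremal_coef (k p m : nat) (a : R) (n : nat) : C :=
  RtoC (mobius_coef a ((n - m) / p - k)).

Lemma extremal_coefE k p m a i : (1 <= p)%nat ->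
  extremal_coef k p m a (p * (k + i) + m) = RtoC (mobius_coef a i).
Proof.
intros Hp; unfold extremal_coef; do 2 f_equal.
replace (p * (k + i) + m - m)%nat with ((k + i) * p)%nat by lia.
rewrite Nat.div_mul by lia; lia.
Qed.

Lemma mobius_denom_neq_0 a w : 0 < a <= 1 -> Cmod w < 1 -> Cminus 1 (Cmult a w) <> 0.
Proof.
intros Ha Hw E.
assert (E1 : Cmult a w = RtoC 1).
{ replace (Cmult a w) with (Cminus 1 (Cminus 1 (Cmult a w))) by ring; rewrite E; ring. }
apply (f_equal Cmod) in E1; rewrite Cmod_mult, Cmod_1, Cmod_pos_real in E1 by lra.
pose proof (Cmod_ge_0 w); nra.
Qed.

(** Rests on the identity [|1-aw|^2 - |a-w|^2 = (1-a^2)(1-|w|^2)]. *)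
Lemma mobius_le_1 a w : 0 < a <= 1 -> Cmod w < 1 -> Cmod (mobius a w) <= 1.
Proof.
intros Ha Hw; pose proof (mobius_denom_neq_0 a w Ha Hw) as H0.
unfold mobius; rewrite Cmod_div by exact H0.
assert (P : 0 < Cmod (Cminus 1 (Cmult a w))) by now apply Cmod_gt_0.
apply Rmult_le_reg_r with (Cmod (Cminus 1 (Cmult a w))); [exact P|].
unfold Rdiv; rewrite Rmult_assoc, Rinv_l, Rmult_1_l, Rmult_1_r by lra.
apply Rnot_lt_le; intros Hlt.
assert (Hsq : Cmod (Cminus 1 (Cmult a w)) ^ 2 < Cmod (Cminus a w) ^ 2) by nra.
assert (Hw2 : Cmod w ^ 2 <= 1) by (pose proof (Cmod_ge_0 w); nra).
assert (Id : Cmod (Cminus 1 (Cmult a w)) ^ 2 - Cmod (Cminus a w) ^ 2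
             = (1 - a ^ 2) * (1 - Cmod w ^ 2)).
{ rewrite !Cmod2_alt; destruct w; simpl; ring. }
assert (0 <= (1 - a ^ 2) * (1 - Cmod w ^ 2)) by (apply Rmult_le_pos; nra).
lra.
Qed.

(** Multiplying by [1 - aw] telescopes the partial sum. The last term is the remainder, which
    [|w| < 1] sends to 0 in [mobius_series]. *)
Lemma mobius_partial_sum a (w : C) n :
  Cmult (csum (fun i => Cmult (mobius_coef a i) (Cpow w i)) n) (Cminus 1 (Cmult a w))
  = Cplus (Cminus a w) (Cmult ((1 - a ^ 2) * a ^ n)%R (Cpow w (S n))).
Proof.
induction n as [|n IH].
- rewrite csum_0; simpl; rewrite !RtoC_mult, RtoC_minus, !RtoC_mult; ring.
- rewrite csum_S, Cmult_plus_distr_r, IH.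
  change (mobius_coef a (S n)) with (- (1 - a ^ 2) * a ^ n).
  change (a ^ S n) with (a * a ^ n).
  rewrite !RtoC_mult, RtoC_opp, !Cpow_S; ring.
Qed.

Lemma mobius_series a (w : C) : 0 < a <= 1 -> Cmod w < 1 ->
  @is_series C_AbsRing C_NormedModule (fun i => Cmult (mobius_coef a i) (Cpow w i)) (mobius a w).
Proof.
intros Ha Hw; pose proof (mobius_denom_neq_0 a w Ha Hw) as H0.
set (q := Cminus 1 (Cmult a w)) in *.
assert (P : 0 < Cmod q) by now apply Cmod_gt_0.
apply is_series_C_eventually; intros eps.
destruct (pow_lt_1_zero (Cmod w) ltac:(rewrite Rabs_pos_eq; auto using Cmod_ge_0)
  (eps * Cmod q) ltac:(apply Rmult_lt_0_compat; [apply cond_pos|exact P])) as (n0 & Hn0).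
exists n0; intros n Hn; specialize (Hn0 (S n) ltac:(lia)).
replace (Cminus (csum (fun i => Cmult (mobius_coef a i) (Cpow w i)) n) (mobius a w))
  with (Cmult (Cmult ((1 - a ^ 2) * a ^ n)%R (Cpow w (S n))) (Cinv q)).
- rewrite Cmod_mult, Cmod_inv by exact H0.
  apply Rmult_lt_reg_r with (Cmod q); [exact P|].
  rewrite Rmult_assoc, Rinv_l, Rmult_1_r by lra.
  eapply Rle_lt_trans; [|exact Hn0].
  rewrite Cmod_mult, Cmod_pow.
  rewrite (Rabs_pos_eq (Cmod w ^ S n)) by (apply pow_le, Cmod_ge_0).
  rewrite <- (Rmult_1_l (Cmod w ^ S n)) at 2.
  apply Rmult_le_compat_r; [apply pow_le, Cmod_ge_0|].
  assert (0 <= a ^ n <= 1).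
  { split; [apply pow_le; lra|]; rewrite <- (pow1 n); apply pow_incr; lra. }
  rewrite Cmod_pos_real by (apply Rmult_le_pos; nra); nra.
- pose proof (mobius_partial_sum a w n) as E; fold q in E.
  replace (csum (fun i => Cmult (mobius_coef a i) (Cpow w i)) n)
    with (Cmult (Cmult (csum (fun i => Cmult (mobius_coef a i) (Cpow w i)) n) q) (Cinv q))
    by (field; exact H0).
  rewrite E; unfold mobius; fold q; unfold Cdiv; ring.
Qed.

Lemma Cmod_pow_lt_1 z p : (1 <= p)%nat -> in_disk z -> Cmod (Cpow z p) < 1.
Proof.
intros Hp Hz; rewrite Cmod_pow; apply pow_lt_1; [|exact Hp].
split; [apply Cmod_ge_0|exact Hz].
Qed.

Lemma extremal_expansion k p m a : (1 <= p)%nat -> 0 < a <= 1 ->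
  has_expansion k p m (extremal_coef k p m a) (extremal k p m a).
Proof.
intros Hp Ha z Hz.
pose proof (is_series_scal (V := C_NormedModule) (Cpow z (p * k + m)) _ _
  (mobius_series a (Cpow z p) Ha (Cmod_pow_lt_1 z p Hp Hz))) as H.
revert H; apply is_series_ext; intros i; rewrite extremal_coefE by exact Hp.
replace (p * (k + i) + m)%nat with ((p * k + m) + p * i)%nat by ring.
rewrite (Cpow_add_r z (p * k + m)), (Cpow_mult_r z p); unfold scal; simpl; unfold mult; simpl.
refine (_ : @eq C _ _); ring.
Qed.

Lemma mobius_pow_smooth p a n : (1 <= p)%nat -> 0 < a <= 1 ->
  C_smooth n (fun z => mobius a (Cpow z p)).
Proof.
intros Hp Ha; apply C_smooth_mult.
- apply (C_smooth_plus n (fun _ => RtoC a) (fun z => Copp (Cpow z p))).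
  + apply C_smooth_const.
  + apply (C_smooth_opp n (fun z => Cpow z p)), C_smooth_pow.
- apply (C_smooth_inv n (fun z => Cminus 1 (Cmult a (Cpow z p)))).
  + intros z Hz; apply mobius_denom_neq_0; [exact Ha|now apply Cmod_pow_lt_1].
  + apply (C_smooth_plus n (fun _ => RtoC 1) (fun z => Copp (Cmult a (Cpow z p)))).
    * apply C_smooth_const.
    * apply (C_smooth_opp n (fun z => Cmult a (Cpow z p))).
      apply C_smooth_mult; [apply C_smooth_const|apply C_smooth_pow].
Qed.

Lemma extremal_smooth k p m a n : (1 <= p)%nat -> 0 < a <= 1 ->
  C_smooth n (extremal k p m a).
Proof.
intros Hp Ha; apply C_smooth_mult; [apply C_smooth_pow|now apply mobius_pow_smooth].
Qed.

Lemma extremal_Bj k p m a : (1 <= p)%nat -> 0 < a <= 1 ->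
  class_Bj (p * k + m) (extremal k p m a).
Proof.
intros Hp Ha; split; [split|].
- intros z Hz; destruct (extremal_smooth k p m a 1 Hp Ha) as (h' & Dh & _).
  exists (h' z); now apply Dh.
- intros z Hz; unfold extremal; rewrite Cmod_mult, Cmod_pow.
  pose proof (mobius_le_1 a (Cpow z p) Ha (Cmod_pow_lt_1 z p Hp Hz)).
  assert (Cmod z ^ (p * k + m) <= 1).
  { rewrite <- (pow1 (p * k + m)); apply pow_incr; split; [apply Cmod_ge_0|].
    left; exact Hz. }
  assert (0 <= Cmod z ^ (p * k + m)) by (apply pow_le, Cmod_ge_0).
  pose proof (Cmod_ge_0 (mobius a (Cpow z p))); nra.
- intros i Hi.
  destruct (C_derive_n_pow_mult (p * k + m) _ (extremal k p m a)
    (mobius_pow_smooth p a (p * k + m) Hp Ha) (fun z _ => eq_refl) i ltac:(lia))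
    as (q & _ & E).
  rewrite E by (unfold in_disk; rewrite Cmod_0; lra).
  replace (p * k + m - i)%nat with (S (p * k + m - i - 1)) by lia.
  rewrite Cpow_S; ring.
Qed.

Lemma extremal_admissible k p m a : (1 <= p)%nat -> 0 < a <= 1 ->
  admissible k p m a
    (fun z => Cplus (extremal k p m a z) (Cconj (extremal k p m a z)))
    (extremal k p m a) (extremal k p m a)
    (extremal_coef k p m a) (extremal_coef k p m a).
Proof.
intros Hp Ha.
assert (H0 : Cmod (extremal_coef k p m a (p * k + m)) = a).
{ rewrite <- (Nat.add_0_r k) at 2; rewrite extremal_coefE by exact Hp.
  apply Cmod_pos_real; simpl; lra. }
split; auto using extremal_expansion, extremal_Bj.
split.
(* Here [f] is twice the real part of the extremal function; its imaginary part is 0 and is covered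
   by [kappa = 0]. *)
- apply (C_smooth_harmonic _ (RtoC 2) (extremal k p m a)); [now apply extremal_smooth|].
  intros x y _; destruct (extremal k p m a (x, y)); simpl; ring.
- apply (C_smooth_harmonic _ (RtoC 0) (extremal k p m a)); [now apply extremal_smooth|].
  intros x y _; destruct (extremal k p m a (x, y)); simpl; ring.
Qed.

Lemma is_series_cons (u : nat -> R) (l : R) :
  is_series (fun i => u (S i)) l -> is_series u (u 0%nat + l).
Proof.
intros H; apply is_series_decr_1.
match goal with |- is_series _ ?x => replace x with l; [exact H|] end.
unfold plus, opp; simpl; ring.
Qed.

(** The Möbius coefficients satisfy [sum_(i<=n) |c_i|^2 = 1 - (1-a^2) a^(2n)], which turns both of
    Carlson's inequalities into equalities. The value itself is computed from the two geometric
    series [U] and [V]. *)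
Lemma extremal_M k p m a r : (1 <= p)%nat -> 0 < a <= 1 -> 0 <= r < 1 ->
  M k p m (extremal_coef k p m a) r = Finite (M_sup k p m a r).
Proof.
intros Hp Ha Hr; set (x := r ^ p).
assert (Hx : 0 <= x < 1) by (now apply pow_lt_1).
assert (Hax : 0 <= a * x < 1) by nra.
set (U := a + (1 - a ^ 2) * x / (1 - a * x)).
set (V := a ^ 2 + (1 - a ^ 2) ^ 2 * x ^ 2 / (1 - (a * x) ^ 2)).
assert (E : forall i, Cmod (extremal_coef k p m a (p * (k + i) + m)) = Rabs (mobius_coef a i)).
{ intros i; now rewrite extremal_coefE, Cmod_R by exact Hp. }
assert (A0 : Rabs (mobius_coef a 0) = a) by (apply Rabs_pos_eq; simpl; lra).
assert (AS : forall i, Rabs (mobius_coef a (S i)) = (1 - a ^ 2) * a ^ i).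
{ intros i; simpl mobius_coef.
  rewrite Ropp_mult_distr_l_reverse, Rabs_Ropp; apply Rabs_pos_eq, Rmult_le_pos.
  - nra.
  - apply pow_le; lra. }
assert (HU : is_series (fun i => Rabs (mobius_coef a i) * x ^ i) U).
{ replace U with (Rabs (mobius_coef a 0) * x ^ 0 + / (1 - a * x) * ((1 - a ^ 2) * x))
    by (rewrite A0; unfold U; simpl; field; lra).
  apply (is_series_cons (fun i => Rabs (mobius_coef a i) * x ^ i)).
  apply is_series_ext with (fun i => (a * x) ^ i * ((1 - a ^ 2) * x)).
  - intros i; rewrite AS, Rpow_mult_distr; refine (_ : @eq R _ _); simpl; ring.
  - apply is_series_scal_r, is_series_geom; rewrite Rabs_pos_eq; lra. }
assert (HV : is_series (fun i => Rabs (mobius_coef a i) ^ 2 * x ^ (2 * i)) V).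
{ replace V with (Rabs (mobius_coef a 0) ^ 2 * x ^ (2 * 0)
                  + / (1 - (a * x) ^ 2) * ((1 - a ^ 2) ^ 2 * x ^ 2))
    by (rewrite A0; unfold V; simpl (x ^ (2 * 0)); field; nra).
  apply (is_series_cons (fun i => Rabs (mobius_coef a i) ^ 2 * x ^ (2 * i))).
  apply is_series_ext with (fun i => ((a * x) ^ 2) ^ i * ((1 - a ^ 2) ^ 2 * x ^ 2)).
  - intros i; rewrite AS; refine (_ : @eq R _ _).
    replace (2 * S i)%nat with (2 + 2 * i)%nat by lia.
    rewrite pow_add, !(pow_mult _ 2), !Rpow_mult_distr, <- !pow_mult, (Nat.mul_comm i 2); ring.
  - apply is_series_scal_r, is_series_geom; rewrite Rabs_pos_eq; nra. }
rewrite (M_eval k p m _ r U V); fold x.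
- rewrite E, A0; f_equal; unfold M_sup; f_equal; fold x; unfold U, V.
  assert (0 <= (a * x) ^ 2 < 1) by nra.
  field; repeat split; nra.
- revert HU; apply is_series_ext; intros i; now rewrite E.
- revert HV; apply is_series_ext; intros i; now rewrite E.
Qed.

Theorem theorem6 (k m p : nat) (a : R)
  (hk : (2 <= k)%nat) (hm : (1 <= m)%nat) (hp : (1 <= p)%nat)
  (hmp : (m <= p)%nat) (ha : 0 < a <= 1) :
  exists s : R,
    unique (is_radius k p m a) s /\
    (forall (f h g : C -> C) (ca cb : nat -> C),
       admissible k p m a f h g ca cb ->
       forall r : R, 0 <= r <= s -> bohr_inequality k p m ca cb r) /\
    (forall t : R, s < t < 1 ->
       ~ (forall (f h g : C -> C) (ca cb : nat -> C),
            admissible k p m a f h g ca cb ->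
            forall r : R, 0 <= r <= t -> bohr_inequality k p m ca cb r)).
Proof.
destruct (radius_exists k p m a hp hm ltac:(lra)) as (s & Hs).
pose proof (proj1 Hs) as Is.
pose proof (proj1 (is_radius_iff k p m a s hp ltac:(lra) Is) Hs) as Es.
exists s; split; [|split].
- split; [exact Hs|]; intros r Hr; now apply (radius_unique k p m a s r hp hm); [lra| |].
- intros f h g ca cb Adm r Hr.
  assert (Hr1 : 0 <= r < 1) by lra.
  destruct (M_le_sup _ k p m ca r
    (expansion_schur k p m ca h hp (adm_exp_h _ _ _ _ _ _ _ _ _ Adm)
       (proj1 (adm_Bj_h _ _ _ _ _ _ _ _ _ Adm))) Hr1 hp) as [Ha Fa].
  destruct (M_le_sup _ k p m cb r
    (expansion_schur k p m cb g hp (adm_exp_g _ _ _ _ _ _ _ _ _ Adm)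
       (proj1 (adm_Bj_g _ _ _ _ _ _ _ _ _ Adm))) Hr1 hp) as [Hb Fb].
  rewrite (adm_coef_h _ _ _ _ _ _ _ _ _ Adm) in Ha.
  rewrite (adm_coef_g _ _ _ _ _ _ _ _ _ Adm) in Hb.
  unfold bohr_inequality; rewrite <- Fa, <- Fb in *; simpl in *.
  (* Each of the two values is at most [M_sup] at [r], and [2 * M_sup] equals 1 at [s]. *)
  assert (M_sup k p m a r <= M_sup k p m a s); [|lra].
  destruct (Req_dec r s) as [->|Hne]; [lra|].
  left; apply M_sup_increasing; auto; lra.
(* The extremal pair evaluated at [r = t] gives [2 * M_sup] at [t], which exceeds its value 1 at
   [s]. *)
- intros t Ht H.
  specialize (H _ _ _ _ _ (extremal_admissible k p m a hp ha) t ltac:(lra)).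
  unfold bohr_inequality in H; rewrite extremal_M in H by (auto; lra); simpl in H.
  pose proof (M_sup_increasing k p m a s t hp hm ltac:(lra) ltac:(lra) ltac:(lra)); lra.
Qed.
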